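(* Let $\mu$ be a distribution in $\mathcal{ID}_+$ with Lévy measure $\nu$, and let $\nu_1=1_{\{x>1\}}\nu/\nu(1,\infty)$ be its normalized Lévy measure. (a) The following assertions are equivalent: (1) $\mu\in\mathcal{J}$; (2) $\nu_1\in\mathcal{J}$. (b) If (1) or (2) holds, then $\overline{\mu}\asymp\overline{\nu_1}$.
   Context: $\mathcal{ID}_+$ is the class of infinitely divisible distributions $\mu$ on $[0,\infty)$ with Laplace transform $\hat\mu(s)=\exp\{\int_0^\infty(e^{-st}-1)\,\nu(dt)\}$, where the Lévy measure $\nu$ satisfies $\overline{\nu}(t):=\nu((t,\infty))>0$ for every $t>0$ and $\int_0^\infty(1\wedge t)\,\nu(dt)<\infty$. For a probability measure $\rho$ on $[0,\infty)$, $\overline{\rho}(t)=\rho((t,\infty))$, and $\rho$ is said to belong to a class of distribution functions if its distribution function does. For positive functions $f,g$ on $[0,\infty)$, $f\asymp g$ means $0<\liminf_{x\to\infty}f(x)/g(x)\le\limsup_{x\to\infty}f(x)/g(x)<\infty$. Let $\mathcal{F}$ be the set of all distribution functions of nonnegative random variables with unbounded support. The class $\mathcal{J}$ is the set of all $F\in\mathcal{F}$ such that, for $X_1,X_2,\ldots$ i.i.d. with distribution function $F$ and for all $n\ge2$, $$\lim_{K\to\infty}\liminf_{x\to\infty}\frac{\mathbb{P}(\max(X_1,\ldots,X_n)>x-K,\;X_1+\cdots+X_n>x)}{\mathbb{P}(X_1+\cdots+X_n>x)}=1.$$ *)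

(* Defs.v *)
From HB Require Import structures.
From mathcomp Require Import all_boot all_order all_algebra.
From mathcomp Require Import all_classical all_reals all_analysis.
Import Order.TTheory GRing.Theory Num.Theory.
Import numFieldNormedType.Exports.

Set Implicit Arguments.
Unset Strict Implicit.
Unset Printing Implicit Defensive.

Local Open Scope classical_set_scope.
Local Open Scope ring_scope.

Definition mutually_independent (R : realType) (d : measure_display)
    (T : measurableType d) (P : probability T R) (n : nat)
    (X : 'I_n -> {RV P >-> R}) : Prop :=
  forall A : 'I_n -> set R, (forall i, measurable (A i)) ->
    P [set w | forall i, A i (X i w)] = (\prod_(i < n) P (X i @^-1` A i))%E.

Definition iid (R : realType) (d : measure_display) (T : measurableType d)
    (P : probability T R) (n : nat) (X : 'I_n -> {RV P >-> R})
    (F : R -> \bar R) : Prop :=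
  mutually_independent X /\ forall i x, cdf (X i) x = F x.

(* The class [\mathcal F]; like the library's [cdf], distribution functions
   take their values in [\bar R]. *)
Definition class_F (R : realType) (F : R -> \bar R) : Prop :=
  exists (d : measure_display) (T : measurableType d) (P : probability T R)
    (X : {RV P >-> R}),
    [/\ forall w, 0 <= X w,
        forall x, (0 < ccdf X x)%E &
        forall x, cdf X x = F x].

Definition one_jump_ratio (R : realType) (d : measure_display)
    (T : measurableType d) (P : probability T R) (n : nat)
    (X : 'I_n -> {RV P >-> R}) (K x : R) : R :=
  fine (P [set w | ((x - K)%:E < \big[maxe/-oo]_(i < n) (X i w)%:E)%E /\
                   x < \sum_(i < n) X i w])
  / fine (P [set w | x < \sum_(i < n) X i w]).

(* The condition depends only on the joint law of the family, so it is
   required of every i.i.d. family on every probability space; only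
   [X_1, ..., X_n] enter the condition for a given [n]. *)
Definition class_J (R : realType) (F : R -> \bar R) : Prop :=
  class_F F /\
  forall n : nat, (2 <= n)%N ->
  forall (d : measure_display) (T : measurableType d) (P : probability T R)
    (X : 'I_n -> {RV P >-> R}), iid X F ->
    limf_einf (fun x : R => (one_jump_ratio X K x)%:E) +oo%R
      @[K --> +oo%R] --> 1%E.

Definition law_in_J (R : realType) (rho : probability R R) : Prop :=
  class_J (fun x : R => rho `]-oo, x]%classic).

Definition infinitely_divisible (R : realType) (mu : probability R R) : Prop :=
  forall n : nat, (0 < n)%N ->
  exists (d : measure_display) (T : measurableType d) (P : probability T R)
    (X : 'I_n -> {RV P >-> R}) (F : R -> \bar R),
    iid X F /\
    forall A : set R, measurable A ->
      P [set w | A (\sum_(i < n) X i w)] = mu A.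

(* A measure on (0, oo) is encoded as a measure on the line that does not
   charge ]-oo, 0]. *)
Definition levy_measure (R : realType) (nu : {measure set R -> \bar R}) : Prop :=
  [/\ nu `]-oo, 0]%classic = 0%E,
      forall t : R, 0 < t -> (0 < nu `]t, +oo[%classic)%E &
      (\int[nu]_(t in `]0%R, +oo[%classic) (Num.min 1 t)%R%:E < +oo)%E].

Definition ID_plus (R : realType) (mu : probability R R)
    (nu : {measure set R -> \bar R}) : Prop :=
  [/\ mu `]-oo, 0[%classic = 0%E,
      infinitely_divisible mu,
      levy_measure nu &
      forall s : R, 0 <= s ->
        (\int[mu]_(t in `[0%R, +oo[%classic) (expR (- (s * t)))%R%:E =
         expeR (\int[nu]_(t in `]0%R, +oo[%classic) (expR (- (s * t)) - 1)%R%:E))%E].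

(* [nu_1]: the default value [\d_0] of [mnormalize] plays no role for a Levy
   measure, for which [0 < nu ]1, +oo[ < +oo]. *)
Definition normalized_levy (R : realType) (nu : {measure set R -> \bar R}) :
    probability R R :=
  mnormalize (mrestr nu (measurable_itv `]1, +oo[)) (\d_(0 : R)).

Definition tail (R : realType) (rho : probability R R) (x : R) : R :=
  fine (rho `]x, +oo[%classic).

Definition asymp_equiv (R : realType) (f g : R -> R) : Prop :=
  let q := fun x : R => (f x / g x)%:E in
  [/\ (0 < limf_einf q +oo%R)%E,
      (limf_einf q +oo%R <= limf_esup q +oo%R)%E &
      (limf_esup q +oo%R < +oo)%E].

(* Main.v *)
Require Import Defs.
From HB Require Import structures.
From mathcomp Require Import all_boot all_order all_algebra.
From mathcomp Require Import all_classical all_reals all_analysis.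
From mathcomp Require Import measurable_realfun ring lra.

(** Let [X], [Y] be independent with laws [p], [q]. The proof is organised around
    the probability [both_exceed p q K x] that [X > K], [Y > K] and [X + Y > x].

    A law [p] on the half-line with unbounded support is in the class J exactly
    when, for a large [K], [both_exceed p p K x] is eventually at most any given
    fraction of the tail of [p] at [x] ([single_big_jump], [law_in_JP]). Indeed
    a sum of two terms exceeding [x] without a term exceeding [x - K] has both
    terms above [K]; the converse has to dispose of the corners where one term
    exceeds [x - K] and the other [K], and does so because J forces the tail to
    be multiplied by a bounded factor under any fixed shift. For [n] terms one
    adds the terms one by one, the partial sums having tails comparable to that
    of [p].

    By Fubini, [both_exceed p q K x] depends on [q] only through its tail beyond
    [K], monotonically, and it is symmetric. Hence replacing [p] by a law with a
    comparable tail changes it by a bounded factor ([single_big_jump_equiv]).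
    Both parts of the theorem thus follow once the tails of [mu] and of the
    normalized Levy measure [nu1] are shown to be comparable as soon as one of
    the two laws has a single big jump.

    This comparison rests on the identity between the size-biased law
    [t mu(dt)] and the convolution of [mu] with [t nu(dt)], which is the
    derivative of the Laplace identity ([laplace_derivative]) read through the
    uniqueness of Laplace transforms ([laplace_unique]). It gives the tail of
    [mu] at [x] as the integral of [t / (u + t)] over [u + t > x] with respect
    to [mu(du) nu(dt)] ([mu_ray_integral]). Jumps [t > x] alone show that the tail of [nu1] is at
    most a multiple of the tail of [mu] ([levy_tail_le]). For the converse, split
    the domain at a threshold [T] ([mu_tail_le]): the part [t <= T] is at most
    [c / x] times the tail of [mu] at [x - T], the part [u <= T] is at most the
    tail of [nu] at [x - T], and the rest is [both_exceed mu nu1 T x] up to a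
    constant. If [mu] has a single big jump, then the first and the last part
    are at most half of the tail of [mu] at [x] and are absorbed
    ([mu_tail_dominated_mu]). If [nu1] has one, let [m] be the supremum of the
    ratio of the two tails on a bounded interval; the same split gives
    [m <= C + m / 2] with [C] independent of the interval
    ([mu_tail_dominated_nu]). *)

Import Order.TTheory GRing.Theory Num.Theory.
Import numFieldNormedType.Exports.

Set Implicit Arguments.
Unset Strict Implicit.
Unset Printing Implicit Defensive.

Local Open Scope classical_set_scope.
Local Open Scope ring_scope.

(** * Events on a product of two laws *)

Section random_variable_of.
Context d (T : measurableType d) (R : realType) (P : probability T R).
Variables (f : T -> R) (mf : measurable_fun setT f).

Let mf_mixin := isMeasurableFun.Build _ _ _ _ f mf.

Definition rv_of : {RV P >-> R} := HB.pack f mf_mixin.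

End random_variable_of.

Section finite_measure_reals.
Context d (T : measurableType d) (R : realType).
Variable m : {finite_measure set T -> \bar R}.

Lemma fine_measure_ge0 A : 0 <= fine (m A).
Proof. by rewrite fine_ge0. Qed.

Lemma EFin_fine_measure A : measurable A -> ((fine (m A))%:E = m A)%E.
Proof. by move=> mA; rewrite fineK// fin_num_measure. Qed.

Lemma fine_measure_le A B : measurable A -> measurable B -> A `<=` B ->
  fine (m A) <= fine (m B).
Proof.
move=> mA mB AB; rewrite fine_le ?fin_num_measure//.
by rewrite le_measure ?inE.
Qed.

Lemma fine_measure_leU A B C : measurable A -> measurable B -> measurable C ->
  A `<=` B `|` C -> fine (m A) <= fine (m B) + fine (m C).
Proof.
move=> mA mB mC ABC; rewrite -fineD ?fin_num_measure// fine_le//.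
- exact: fin_num_measure.
- by rewrite fin_numD !fin_num_measure.
apply: (le_trans _ (measureU2 _ _ _)) => //.
by rewrite le_measure ?inE//; exact: measurableU.
Qed.

End finite_measure_reals.

Section product_probability.
Context (R : realType) (p q : probability R R).

Definition product_prob := (p \x q)%E.

HB.instance Definition _ := Measure.on product_prob.

Let product_prob_setT : product_prob setT = 1%E.
Proof.
rewrite /product_prob -setXTT [LHS]product_measure1E//=.
by rewrite !probability_setT mule1.
Qed.

HB.instance Definition _ :=
  Measure_isProbability.Build _ _ _ product_prob product_prob_setT.

End product_probability.

Lemma product_probE (R : realType) (p q : probability R R) A B :
  measurable A -> measurable B ->
  product_prob p q (A `*` B) = (p A * q B)%E.
Proof. exact: product_measure1E. Qed.

Section exceed.
Context (R : realType).
Implicit Types (p q : probability R R) (K x : R).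

Definition exceed_set K x : set (R * R) :=
  [set z | [/\ K < z.1, K < z.2 & x < z.1 + z.2]].

Lemma measurable_sum_gt x : measurable [set z : R * R | x < z.1 + z.2].
Proof.
have : measurable_fun [set: R * R] (fun z : R * R => z.1 + z.2).
  exact: measurable_funD.
move=> /(_ measurableT `]x, +oo[%classic (measurable_itv _)).
rewrite setTI; congr measurable.
by apply/seteqP; split => z /=; rewrite in_itv/= andbT.
Qed.

Lemma measurable_exceed K x : measurable (exceed_set K x).
Proof.
have -> : exceed_set K x = (`]K, +oo[%classic `*` `]K, +oo[%classic) `&`
    [set z | x < z.1 + z.2].
  apply/seteqP; split => z /=; rewrite !in_itv/= !andbT.
    by move=> [].
  by move=> [[]].
by apply: measurableI; [exact: measurableX|exact: measurable_sum_gt].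
Qed.

(** The probability of a sum exceeding [x] through two terms that are both
    large; the comparison of tails rests on it. *)
Definition both_exceed p q K x : R := fine (product_prob p q (exceed_set K x)).

Lemma exceed_integral p (m : {sigma_finite_measure set R -> \bar R}) K x :
  ((p \x m) (exceed_set K x) =
   \int[p]_(y in `]K, +oo[%classic) m `](Num.max K (x - y))%R, +oo[%classic)%E.
Proof.
rewrite [RHS]integral_mkcond /product_measure1/=.
apply: eq_integral => y _ /=; rewrite patchE.
case: ifPn => [|]; rewrite ?inE ?notin_setE/= in_itv/= andbT => Ky.
  congr (m _); apply/seteqP; split => z; rewrite /xsection/= in_itv/= andbT gt_max in_setE.
    by move=> [_ Kz xz]; rewrite Kz ltrBlDl.
  by move=> /andP[Kz xz]; split => //; rewrite -ltrBlDl.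
rewrite [X in m X](_ : _ = set0) ?measure0//.
by apply/seteqP; split => z; rewrite /xsection/= in_setE//= => -[].
Qed.

Lemma both_exceedC p q K x : both_exceed p q K x = both_exceed q p K x.
Proof.
have mswap : measurable_fun setT (fun z : R * R => (z.2, z.1)).
  exact: measurable_fun_pair.
pose m' := pushforward (product_prob q p) (fun z : R * R => (z.2, z.1)).
rewrite /both_exceed /product_prob; congr fine.
rewrite (product_measure_unique (m' := [the measure _ _ of m' ])).
- rewrite /= /m' /pushforward /=; congr (_ _).
  apply/seteqP; split => z [] /= ? ? ?; split => //=; rewrite addrC//.
- move=> A B mA mB; rewrite /= /m' /pushforward/= muleC -product_measure1E//.
  rewrite /product_prob; congr (_ _).
  by apply/seteqP; split => z [].
- exact: measurable_exceed.
Qed.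

End exceed.

Section tail_lemmas.
Context (R : realType).
Implicit Types (p q : probability R R).

Definition sum_tail p q x : R := fine (product_prob p q [set z | x < z.1 + z.2]).

Lemma tail_ge0 p x : 0 <= tail p x.
Proof. exact: fine_measure_ge0. Qed.

Lemma tail_le1 p x : tail p x <= 1.
Proof.
by rewrite -lee_fin EFin_fine_measure//; exact: probability_le1.
Qed.

Lemma EFin_tail p x : (tail p x)%:E = p `]x, +oo[%classic.
Proof. by rewrite EFin_fine_measure. Qed.

Lemma ray_subset (x y : R) : x <= y -> `]y, +oo[%classic `<=` `]x, +oo[%classic.
Proof.
by move=> xy z/=; rewrite !in_itv/= !andbT; exact: le_lt_trans.
Qed.

Lemma tail_noninc p x y : x <= y -> tail p y <= tail p x.
Proof. by move=> xy; apply: fine_measure_le => //; exact: ray_subset. Qed.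

Lemma tail_small p e : 0 < e -> \forall x \near +oo, tail p x <= e.
Proof.
move=> e0.
pose X : {RV p >-> R} := rv_of p (@measurable_id _ _ setT).
have cdfE x : cdf X x = (1 - tail p x)%:E.
  rewrite EFinB EFin_tail -(cdf_ccdf_1 X x) /ccdf /distribution/= /pushforward preimage_id.
  by rewrite addeK// fin_num_measure.
have := cvg_cdfy1 X; rewrite (funext cdfE).
move=> /fine_cvgP[_ /cvgrPdist_le/(_ _ e0)].
apply: filterS => x /=.
by rewrite opprB addrC subrK ger0_norm// tail_ge0.
Qed.

(** When one of the two terms does not exceed [K], the other exceeds [x - K]. *)
Lemma sum_tail_le p q K x :
  sum_tail p q x <=
  both_exceed p q K x + (tail p (x - K) + tail q (x - K)).
Proof.
have mA : measurable (`]x - K, +oo[ `*` [set: R] : set (R * R)).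
  exact: measurableX.
have mB : measurable ([set: R] `*` `]x - K, +oo[ : set (R * R)).
  exact: measurableX.
apply: (le_trans (fine_measure_leU _ _ (measurable_exceed K x)
  (measurableU _ _ mA mB) _)).
- exact: measurable_sum_gt.
- move=> z /= xz; rewrite /exceed_set/= !in_itv/= !andbT.
  case: (ltP K z.1) => Kz1; last by right; right; split => //; lra.
  by case: (ltP K z.2) => Kz2; [left|right; left; split => //; lra].
rewrite lerD2l (le_trans (fine_measure_leU _ _ mA mB _))//; first exact: measurableU.
rewrite /tail /= !product_probE//.
by rewrite !probability_setT mule1 mul1e.
Qed.

Lemma tail_mul_le_sum_tail p q b x :
  tail p (x - b) * tail q b <= sum_tail p q x.
Proof.
have mA : measurable (`]x - b, +oo[ `*` `]b, +oo[ : set (R * R)).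
  exact: measurableX.
apply: (@le_trans _ _ (fine (product_prob p q (`]x - b, +oo[ `*` `]b, +oo[)))).
  by rewrite product_probE// fineM ?fin_num_measure.
apply: fine_measure_le => //; first exact: measurable_sum_gt.
by move=> z/=; rewrite !in_itv/= !andbT => -[]; lra.
Qed.

Lemma tail_le_sum_tail p q x : q `]-oo, 0[%classic = 0%E ->
  tail p x <= sum_tail p q x.
Proof.
move=> q0.
have mA : measurable (`]x, +oo[ `*` `[0, +oo[ : set (R * R)).
  exact: measurableX.
have q1 : q `[0, +oo[%classic = 1%E.
  rewrite -[LHS]add0e -q0 -measureU//=; last first.
    by apply/seteqP; split => z//=; rewrite !in_itv/= andbT => -[]; lra.
  rewrite -(probability_setT q); congr (_ _).
  apply/seteqP; split => z//= _; rewrite !in_itv/= andbT.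
  by case: (ltP z 0); [left|right].
apply: (@le_trans _ _ (fine (product_prob p q (`]x, +oo[ `*` `[0, +oo[)))).
  by rewrite product_probE// q1 mule1.
apply: fine_measure_le => //; first exact: measurable_sum_gt.
by move=> z/=; rewrite !in_itv/= !andbT => -[]; lra.
Qed.

Lemma both_exceed_noninc p q K L x : K <= L ->
  both_exceed p q L x <= both_exceed p q K x.
Proof.
move=> KL; apply: fine_measure_le; [exact: measurable_exceed..|].
by move=> z [] /= ? ? ?; split => //; exact: le_lt_trans KL _.
Qed.

Lemma EFin_both_exceed p q K x : ((both_exceed p q K x)%:E =
  \int[p]_(y in `]K, +oo[%classic) q `](Num.max K (x - y))%R, +oo[%classic)%E.
Proof.
by rewrite EFin_fine_measure; [exact: exceed_integral|exact: measurable_exceed].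
Qed.

Lemma measurable_fun_exceed_ray q (K x : R) : measurable_fun `]K, +oo[%classic
  (fun y => q `](Num.max K (x - y))%R, +oo[%classic).
Proof.
apply: (eq_measurable_fun (q \o xsection (exceed_set K x))).
  move=> y; rewrite inE/= in_itv/= andbT => Ky; congr (q _).
  apply/seteqP; split => z; rewrite /xsection/= in_itv/= andbT gt_max in_setE.
    by move=> [_ Kz xz]; rewrite Kz ltrBlDl.
  by move=> /andP[Kz xz]; split => //; rewrite -ltrBlDl.
apply: measurable_funTS; apply: measurable_fun_xsection.
exact: measurable_exceed.
Qed.

(** The second coordinate enters the event only through rays beyond some point
    between [K] and [x - K], so the law of one coordinate may be exchanged for
    another with a comparable tail. *)
Lemma both_exceed_dominated p q1 q2 C K x :
  (forall y, K <= y <= Num.max K (x - K) -> tail q1 y <= C * tail q2 y) ->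
  both_exceed p q1 K x <= C * both_exceed p q2 K x.
Proof.
move=> q12.
have {}q12 y : K < y -> tail q1 (Num.max K (x - y)) <= C * tail q2 (Num.max K (x - y)).
  move=> Ky; apply: q12; rewrite le_max lexx/= ge_max le_max lexx/= le_max.
  by apply/orP; right; rewrite lerD2l lerN2 ltW.
have [C0|C0] := ltP C 0.
  have q1K y : K < y -> tail q1 (Num.max K (x - y)) = 0.
    move=> /q12 h; apply/eqP; rewrite eq_le tail_ge0 andbT.
    by rewrite (le_trans h)// nmulr_rle0// tail_ge0.
  have q2K y : K < y -> tail q2 (Num.max K (x - y)) = 0.
    move=> Ky; have := q12 _ Ky; rewrite q1K// nmulr_rge0//.
    by move=> h; apply/eqP; rewrite eq_le tail_ge0 h.
  have z q : (forall y, K < y -> tail q (Num.max K (x - y)) = 0) ->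
      both_exceed p q K x = 0.
    move=> h; apply: EFin_inj; rewrite EFin_both_exceed.
    rewrite integral0_eq// => y /=; rewrite in_itv/= andbT => Ky.
    by rewrite -EFin_tail h.
  by rewrite (z _ q1K) (z _ q2K) mulr0.
rewrite -lee_fin EFinM !EFin_both_exceed.
have mm q := @measurable_fun_exceed_ray q K x.
rewrite -ge0_integralZl//.
apply: ge0_le_integral => //.
- by apply: measurable_funeM; exact: mm.
- move=> y /=; rewrite in_itv/= andbT => Ky.
  by rewrite -!EFin_tail -EFinM lee_fin q12.
Qed.

Corollary both_exceed_dominated_ray p q1 q2 C K x :
  (forall y, K <= y -> tail q1 y <= C * tail q2 y) ->
  both_exceed p q1 K x <= C * both_exceed p q2 K x.
Proof.
by move=> q12; apply: both_exceed_dominated => y /andP[Ky _]; exact: q12.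
Qed.

End tail_lemmas.

(** * Laws whose large sums have a single large term *)

Section single_big_jump.
Context (R : realType).
Implicit Types (p q : probability R R).

Definition tail_dominated q p :=
  exists2 C : R, 0 < C & \forall x \near +oo, tail q x <= C * tail p x.

Definition shift_bounded p := forall a : R,
  exists2 C : R, 0 < C & \forall x \near +oo, tail p (x - a) <= C * tail p x.

(** The condition defining the class J, for two terms and freed of the maximum:
    the event is symmetric in the two terms, and it is compared with the tail of
    one term rather than of the sum. Both changes are what makes the condition
    stable when the tail is replaced by a comparable one. *)
Definition single_big_jump p := forall e : R, 0 < e ->
  exists K : R, \forall x \near +oo, both_exceed p p K x <= e * tail p x.

Lemma near_pinfty_shift (P : R -> Prop) (c : R) :
  (\forall x \near +oo, P x) -> \forall x \near +oo, P (x + c).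
Proof.
move=> [M [Mr MP]]; exists (M - c); split; first by rewrite num_real.
by move=> x Mx; apply: MP; rewrite -ltrBlDr.
Qed.

Lemma near_pinfty_ex (P : R -> Prop) (a : R) :
  (\forall x \near +oo, P x) -> exists2 M, a <= M & forall x, M <= x -> P x.
Proof.
move=> [M [Mr MP]]; exists (Num.max a (M + 1)); first by rewrite le_max lexx.
move=> x; rewrite ge_max => /andP[_ Mx]; apply: MP.
by rewrite (lt_le_trans _ Mx)// ltrDl.
Qed.

(** A shift of the tail is paid for by one of the two summands: if it is
    beyond [b], with [b] as large as desired, then the sum exceeds [x] as soon
    as the other summand exceeds [x - b]. *)
Lemma sum_tail_shift_bounded p (C K : R) : (forall x, 0 < tail p x) -> 0 < C ->
  (\forall x \near +oo, sum_tail p p x <= C * tail p (x - K)) ->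
  shift_bounded p.
Proof.
move=> p0 C0 sC a; exists (C / tail p (a + K)); first by rewrite divr_gt0.
have := near_pinfty_shift K sC; apply: filterS => x; rewrite addrK => sx.
rewrite mulrAC ler_pdivlMr// (le_trans _ sx)//.
apply: le_trans (tail_mul_le_sum_tail p p (a + K) _).
by rewrite opprD addrACA subrr addr0.
Qed.

Section nonnegative.
Variable p : probability R R.
Hypothesis p_ge0 : p `]-oo, 0[%classic = 0%E.
Hypothesis p_gt0 : forall x, 0 < tail p x.

Lemma single_big_jump_sum_tail : single_big_jump p ->
  exists K, \forall x \near +oo, sum_tail p p x <= 4 * tail p (x - K).
Proof.
move=> /(_ 2^-1); rewrite invr_gt0 ltr0n => /(_ isT)[K sK]; exists K.
apply: filterS sK => x sK.
by have := sum_tail_le p p K x; have := tail_le_sum_tail p x p_ge0; lra.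
Qed.

Lemma single_big_jump_shift_bounded : single_big_jump p -> shift_bounded p.
Proof.
move=> /single_big_jump_sum_tail[K sK].
by apply: sum_tail_shift_bounded sK; rewrite // ltr0n.
Qed.

End nonnegative.

(** Stability under weak tail equivalence: exchange the two coordinates of
    the event one after the other. *)
Lemma single_big_jump_equiv p q : tail_dominated q p -> tail_dominated p q ->
  single_big_jump p -> single_big_jump q.
Proof.
move=> [C C0 qp] [C' C'0 pq] sp e e0.
have CC0 : 0 < C * (C * C') by rewrite !mulr_gt0.
have [K sK] := sp _ (divr_gt0 e0 CC0).
have [L KL qpL] := near_pinfty_ex K qp.
exists L; apply: filterS2 sK pq => x sK pqx.
apply: (le_trans (both_exceed_dominated_ray q (q2 := p) (C := C) _ _)) => //.
rewrite both_exceedC.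
apply: (@le_trans _ _ (C * (C * both_exceed p p L x))).
  by rewrite ler_pM2l// both_exceed_dominated_ray.
apply: (@le_trans _ _ (C * (C * (e / (C * (C * C')) * tail p x)))).
  by rewrite !ler_pM2l// (le_trans _ sK)// both_exceed_noninc.
have -> : C * (C * (e / (C * (C * C')) * tail p x)) = e * (tail p x / C').
  by field; rewrite !gt_eqF.
by rewrite ler_pM2l// ler_pdivrMr// mulrC.
Qed.

Definition no_big_jump p K x : R := fine (product_prob p p
  [set z | [/\ z.1 <= x - K, z.2 <= x - K & x < z.1 + z.2]]).

Lemma measurable_no_big_jump (K x : R) : measurable
  [set z : R * R | [/\ z.1 <= x - K, z.2 <= x - K & x < z.1 + z.2]].
Proof.
rewrite (_ : [set _ | _] = (`]-oo, x - K] `*` `]-oo, x - K]) `&`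
    [set z : R * R | x < z.1 + z.2]).
  by apply: measurableI; [exact: measurableX|exact: measurable_sum_gt].
apply/seteqP; split => z /=; rewrite !in_itv/=; first by case.
by case=> -[].
Qed.

Lemma both_exceed_le_no_big_jump p K x : both_exceed p p K x <=
  no_big_jump p K x + 2 * (tail p (x - K) * tail p K).
Proof.
have mA : measurable (`]x - K, +oo[ `*` `]K, +oo[ : set (R * R)).
  exact: measurableX.
have mB : measurable (`]K, +oo[ `*` `]x - K, +oo[ : set (R * R)).
  exact: measurableX.
apply: (le_trans (fine_measure_leU _ _ (measurable_no_big_jump K x)
  (measurableU _ _ mA mB) _)).
- exact: measurable_exceed.
- move=> z [/= Kz1 Kz2 xz]; rewrite !in_itv/= !andbT.
  case: (ltP (x - K) z.1) => xz1; first by right; left.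
  by case: (ltP (x - K) z.2) => xz2; [right; right|left].
rewrite lerD2l (le_trans (fine_measure_leU _ _ mA mB _))//; first exact: measurableU.
rewrite /= !product_probE// !fineM ?fin_num_measure//.
by rewrite -!/(tail _ _) (mulrC (tail p K)); lra.
Qed.

(** The rectangle [x - L < X_1 <= x - K], [L < X_2 <= x - K] has no big jump. *)
Lemma tail_increments_le_no_big_jump p K L x : K <= L ->
  (tail p (x - L) - tail p (x - K)) * (tail p L - tail p (x - K)) <=
  no_big_jump p K x.
Proof.
move=> KL.
have itvE a b : a <= b -> fine (p `]a, b]%classic) = tail p a - tail p b.
  move=> ab; have : p `]a, +oo[%classic = (p `]a, b]%classic + p `]b, +oo[%classic)%E.
    rewrite -measureU//; last first.
      by apply/seteqP; split => z//=; rewrite !in_itv/= !andbT => -[/andP[]]; lra.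
    congr (p _); apply/seteqP; split => z/=; rewrite !in_itv/= !andbT.
      by move=> az; case: (leP z b) => zb; [left; rewrite az|right].
    by move=> [/andP[]//|]; exact: le_lt_trans.
  by rewrite /tail => ->; rewrite fineD ?fin_num_measure// addrK.
have [xL|xL] := leP L (x - K); last first.
  apply: (@le_trans _ _ 0); last exact: fine_measure_ge0.
  rewrite mulr_ge0_le0//; first by rewrite subr_ge0 tail_noninc// lerD2l lerN2.
  by rewrite subr_le0 tail_noninc// ltW.
rewrite -!itvE// ?lerD2l ?lerN2// -fineM ?fin_num_measure//.
rewrite -product_probE//; apply: fine_measure_le.
- exact: measurableX.
- exact: measurable_no_big_jump.
- by move=> z/=; rewrite !in_itv/= => -[/andP[? ?] /andP[? ?]]; split => //; lra.
Qed.

(** The estimate on the event without big jump first bounds the tail of the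
    sum by a shifted tail, whence the shifts are bounded. What remains between
    the two events are the corners where one coordinate exceeds [x - L] and
    the other [L]; the rectangles above bound them. *)
Lemma single_big_jumpP p : p `]-oo, 0[%classic = 0%E ->
  (forall x, 0 < tail p x) ->
  (forall e : R, 0 < e -> exists K : R, \forall x \near +oo,
     no_big_jump p K x <= e * sum_tail p p x) ->
  single_big_jump p.
Proof.
move=> p_ge0 p_gt0 nb.
have no_big_jump_noninc K L x : K <= L ->
    no_big_jump p L x <= no_big_jump p K x.
  move=> KL; apply: fine_measure_le; [exact: measurable_no_big_jump..|].
  by move=> z [/= ? ? ?]; split => //; lra.
have [K0 sK0] : exists K, \forall x \near +oo, sum_tail p p x <= 4 * tail p (x - K).
  have [K sK] := nb 2^-1 ltac:(by rewrite invr_gt0 ltr0n).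
  exists K; apply: filterS sK => x sK.
  have mA : measurable (`]x - K, +oo[ `*` [set: R] : set (R * R)).
    exact: measurableX.
  have mB : measurable ([set: R] `*` `]x - K, +oo[ : set (R * R)).
    exact: measurableX.
  have : sum_tail p p x <= no_big_jump p K x + (tail p (x - K) + tail p (x - K)).
    apply: (le_trans (fine_measure_leU _ _ (measurable_no_big_jump K x)
      (measurableU _ _ mA mB) _)).
    - exact: measurable_sum_gt.
    - move=> z /= xz; rewrite !in_itv/= !andbT.
      case: (ltP (x - K) z.1) => xz1; first by right; left.
      by case: (ltP (x - K) z.2) => xz2; [right; right|left].
    rewrite lerD2l (le_trans (fine_measure_leU _ _ mA mB _))//.
      exact: measurableU.
    rewrite /tail /= !product_probE//.
    by rewrite !probability_setT mule1 mul1e.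
  lra.
have sb : shift_bounded p by apply: sum_tail_shift_bounded sK0; rewrite ?ltr0n.
have [C C0 sC] : exists2 C, 0 < C & \forall x \near +oo,
    sum_tail p p x <= C * tail p x.
  have [C C0 sC] := sb K0; exists (4 * C); first by rewrite mulr_gt0.
  by apply: filterS2 sK0 sC => x sK0 sC; lra.
move=> e e0.
have e40 : 0 < e / 8 / C by rewrite !divr_gt0.
have [K1 sK1] := nb _ e40.
have [C1 C10 sC1] := sb K1.
(* [L] comes after [K1]: the tail at [L] has to beat the constant [C1] of the
   shift by [K1]. *)
have eC1 : 0 < Num.min 1 (e / 8 / C1) by rewrite lt_min ltr01/= !divr_gt0.
have [L K1L tL] := near_pinfty_ex K1 (tail_small p eC1).
have tLe : tail p L * C1 <= e / 8.
  by rewrite -ler_pdivlMr//; move: (tL _ (lexx _)); rewrite le_min => /andP[].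
exists L.
have tL2 : 0 < tail p L / 2 by rewrite divr_gt0.
have sL2 := near_pinfty_shift (- K1) (tail_small p tL2).
near=> x.
have nx : no_big_jump p K1 x <= e / 8 * tail p x.
  have -> : e / 8 * tail p x = e / 8 / C * (C * tail p x).
    by field; rewrite gt_eqF.
  apply: (@le_trans _ _ (e / 8 / C * sum_tail p p x)); first by near: x.
  by rewrite ler_pM2l//; near: x.
have corner : tail p (x - L) * tail p L <= 3 * (e / 8) * tail p x.
  have t1 : tail p (x - K1) <= C1 * tail p x by near: x.
  have t2 : tail p (x - K1) <= tail p L / 2 by near: x.
  have inc := le_trans (tail_increments_le_no_big_jump p x K1L) nx.
  have d0 : 0 <= tail p (x - L) - tail p (x - K1).
    by rewrite subr_ge0 tail_noninc// lerD2l lerN2.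
  have h1 : (tail p (x - L) - tail p (x - K1)) * (tail p L / 2) <=
      e / 8 * tail p x.
    by apply: le_trans inc; rewrite ler_wpM2l//; lra.
  have h2 : tail p (x - K1) * tail p L <= e / 8 * tail p x.
    apply: (@le_trans _ _ (C1 * tail p x * tail p L)).
      by rewrite ler_wpM2r// tail_ge0.
    by rewrite mulrAC (mulrC C1) ler_wpM2r// tail_ge0.
  move: h1 h2; set a := tail p (x - L); set b := tail p (x - K1).
  by set c := tail p L; set d := tail p x; nra.
have := both_exceed_le_no_big_jump p L x.
have := no_big_jump_noninc _ _ x K1L.
have := p_gt0 x.
by nra.
Unshelve. all: by end_near.
Qed.

End single_big_jump.

(** * Inferior limits at infinity *)

Section limits_inferior.
Context (R : realType).
Implicit Types (f : R -> R) (r : R -> R -> R).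

Lemma limf_einf_gt f (a : R) :
  (a%:E < limf_einf (fun x => (f x)%:E) +oo%R)%E -> \forall x \near +oo, a <= f x.
Proof.
rewrite limf_einfE => /ereal_sup_gt[_ [V Voo <-] aV].
apply: filterS Voo => x Vx; rewrite -lee_fin (le_trans (ltW aV))//.
by apply: ereal_inf_lbound; exists x.
Qed.

Lemma limf_einf_ge f (a : R) : (\forall x \near +oo, a <= f x) ->
  (a%:E <= limf_einf (fun x => (f x)%:E) +oo%R)%E.
Proof.
move=> af; rewrite limf_einfE; apply: le_ereal_sup_tmp.
exists (ereal_inf ((fun x => (f x)%:E) @` [set x | a <= f x])).
  by exists [set x | a <= f x].
by apply: le_ereal_inf_tmp => _ [x ax <-]; rewrite lee_fin.
Qed.

Lemma limf_esup_le f (a : R) : (\forall x \near +oo, f x <= a) ->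
  (limf_esup (fun x => (f x)%:E) +oo%R <= a%:E)%E.
Proof.
move=> fa; rewrite limf_esupE; apply: ge_ereal_inf.
exists (ereal_sup ((fun x => (f x)%:E) @` [set x | f x <= a])).
  by exists [set x | f x <= a].
by apply: ge_ereal_sup => _ [x ax <-]; rewrite lee_fin.
Qed.

Lemma limf_einf_le_esup f :
  (limf_einf (fun x => (f x)%:E) +oo%R <= limf_esup (fun x => (f x)%:E) +oo%R)%E.
Proof.
rewrite limf_einfE limf_esupE; apply: ge_ereal_sup => _ [U Uoo <-].
apply: le_ereal_inf_tmp => _ [V Voo <-].
have [x [Ux Vx]] := filter_ex (filterI Uoo Voo).
apply: (@le_trans _ _ (f x)%:E).
  by apply: ereal_inf_lbound; exists x.
by apply: ereal_sup_ubound; exists x.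
Qed.

Lemma asymp_equivP f g (c C : R) : 0 < c ->
  (\forall x \near +oo, 0 < g x) ->
  (\forall x \near +oo, c * g x <= f x) ->
  (\forall x \near +oo, f x <= C * g x) -> asymp_equiv f g.
Proof.
move=> c0 g0 gf fg; split => /=; last 1 first.
- apply: (@le_lt_trans _ _ C%:E); last exact: ltry.
  by apply: limf_esup_le; apply: filterS2 g0 fg => x g0; rewrite ler_pdivrMr.
- apply: (@lt_le_trans _ _ c%:E); first by rewrite lte_fin.
  by apply: limf_einf_ge; apply: filterS2 g0 gf => x g0; rewrite ler_pdivlMr.
- exact: limf_einf_le_esup.
Qed.

(** Monotonicity in [K] turns the outer limit into a supremum, so that one [K]
    suffices for each [e]. *)
Lemma limf_einf_cvg1 r : (forall K x, r K x <= 1) ->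
  (forall x, {homo r ^~ x : K L / K <= L}) ->
  (limf_einf (fun x => (r K x)%:E) +oo @[K --> +oo] --> 1%E) <->
  (forall e, 0 < e -> exists K, \forall x \near +oo, 1 - e <= r K x).
Proof.
move=> r1 r_nd; set l := fun K : R => _.
have l1 K : (l K <= 1)%E.
  apply: le_trans (limf_einf_le_esup _) _.
  by apply: limf_esup_le; exact: nearW.
have l_nd : nondecreasing_fun l.
  move=> K L KL; rewrite /l !limf_einfE; apply: ge_ereal_sup => _ [V Voo <-].
  apply: le_ereal_sup_tmp; exists (ereal_inf ((fun x => (r L x)%:E) @` V)).
    by exists V.
  apply: le_ereal_inf_tmp => _ [x Vx <-].
  apply: (@le_trans _ _ (r K x)%:E); last by rewrite lee_fin r_nd.
  by apply: ereal_inf_lbound; exists x.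
split=> [l_1 e e0|r_1].
  have le : \forall K \near +oo, ((1 - e)%:E < l K)%E.
    apply: (l_1 [set y | ((1 - e)%:E < y)%E]); apply: open_nbhs_nbhs.
    by split; [exact: open_ereal_gt_ereal|rewrite /= lte_fin ltrBlDr ltrDl].
  by have [K /limf_einf_gt] := filter_ex le; exists K.
have := nondecreasing_cvge l_nd.
suff -> : ereal_sup (range l) = 1%E by [].
apply/eqP; rewrite eq_le; apply/andP; split.
  by apply: ge_ereal_sup => _ [K _ <-].
apply/lee_addgt0Pr => e e0; have [K rK] := r_1 _ e0.
rewrite -leeBlDr//; apply: (@le_trans _ _ (l K)).
  by rewrite -EFinB; exact: limf_einf_ge.
by apply: ereal_sup_ubound; exists K.
Qed.

End limits_inferior.

(** * The class J and two independent copies *)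

Section one_jump_ratio_lemmas.
Context (R : realType) d (T : measurableType d) (P : probability T R) (n : nat).
Variable X : 'I_n -> {RV P >-> R}.

Let S w := \sum_(i < n) X i w.

Lemma measurable_sum_RV_gt x : measurable [set w | x < S w].
Proof.
have mS : measurable_fun setT S by exact: measurable_sum.
have := mS measurableT _ (measurable_itv `]x, +oo[).
rewrite setTI; congr measurable.
by apply/seteqP; split => z /=; rewrite in_itv/= andbT.
Qed.

Lemma lt_bigmaxeP w (y : R) :
  (y%:E < \big[maxe/-oo]_(i < n) (X i w)%:E)%E <-> exists i, y < X i w.
Proof.
split=> [/bigmax_gtP[|[i _]]|[i yi]].
- by rewrite ltNge leNye.
- by rewrite lte_fin; exists i.
by rewrite (@lt_le_trans _ _ (X i w)%:E)// ?lte_fin//; exact: le_bigmax.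
Qed.

Lemma measurable_no_jump K x :
  measurable [set w | (forall i, X i w <= x - K) /\ x < S w].
Proof.
rewrite (_ : [set _ | _] = (\bigcap_(i in [set: 'I_n]) X i @^-1` `]-oo, x - K]) `&`
    [set w | x < S w]).
  apply: measurableI; last exact: measurable_sum_RV_gt.
  apply: fin_bigcap_measurable => // i _.
  by rewrite -[_ @^-1` _]setTI; exact: measurable_funP.
by apply/seteqP; split => w /= [h xS]; split => // i; have := h i;
  rewrite /= in_itv/=; [|exact].
Qed.

Let jump K x := [set w | ((x - K)%:E < \big[maxe/-oo]_(i < n) (X i w)%:E)%E /\
                   x < S w].

Lemma jumpE K x : jump K x =
  [set w | x < S w] `\` [set w | (forall i, X i w <= x - K) /\ x < S w].
Proof.
apply/seteqP; split => w /=.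
  move=> [/lt_bigmaxeP[i xi] xS]; split => // -[/(_ i)].
  by rewrite leNgt xi.
move=> [xS h]; split => //; apply/lt_bigmaxeP; apply: contrapT => g.
apply: h; split => // i; rewrite leNgt; apply/negP => xi.
by apply: g; exists i.
Qed.

Lemma measurable_jump K x : measurable (jump K x).
Proof.
rewrite jumpE; apply: measurableD; first exact: measurable_sum_RV_gt.
exact: measurable_no_jump.
Qed.

Lemma one_jump_ratio_le1 K x : one_jump_ratio X K x <= 1.
Proof.
rewrite /one_jump_ratio; have [->|p0] := eqVneq (fine (P [set w | x < S w])) 0.
  by rewrite invr0 mulr0.
rewrite ler_pdivrMr ?mul1r; last by rewrite lt_def p0 fine_measure_ge0.
apply: fine_measure_le; [exact: measurable_jump|exact: measurable_sum_RV_gt|].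
by move=> w [].
Qed.

Lemma one_jump_ratio_nd x : {homo one_jump_ratio X ^~ x : K L / K <= L}.
Proof.
move=> K L KL; rewrite /one_jump_ratio ler_wpM2r ?invr_ge0 ?fine_measure_ge0//.
apply: fine_measure_le; [exact: measurable_jump..|].
move=> w [h xS]; split => //; apply: le_lt_trans h.
by rewrite lee_fin lerD2l lerN2.
Qed.

Lemma one_jump_ratio_ge (e : R) K x : 0 < fine (P [set w | x < S w]) ->
  (1 - e <= one_jump_ratio X K x) =
  (fine (P [set w | (forall i, X i w <= x - K) /\ x < S w]) <=
   e * fine (P [set w | x < S w])).
Proof.
move=> p0; rewrite /one_jump_ratio -/(S _) ler_pdivlMr//.
rewrite -/(jump K x) jumpE measureD; [|exact: measurable_sum_RV_gt|
  exact: measurable_no_jump|]; last first.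
  by rewrite -ge0_fin_numE// fin_num_measure//; exact: measurable_sum_RV_gt.
rewrite setIidr; last by move=> w [].
rewrite fineB ?fin_num_measure//; [|exact: measurable_sum_RV_gt|
  exact: measurable_no_jump].
by rewrite mulrBl mul1r lerD2l lerN2.
Qed.

End one_jump_ratio_lemmas.

Section J_single_big_jump.
Context (R : realType) (p : probability R R).
Hypothesis p_ge0 : p `]-oo, 0[%classic = 0%E.
Hypothesis p_gt0 : forall x, 0 < tail p x.

Let coordinate (i : 'I_2) : {RV (product_prob p p) >-> R} :=
  if i == ord0 then rv_of (product_prob p p) measurable_fst
  else rv_of (product_prob p p) measurable_snd.

Let coordinateE i A : measurable A ->
  product_prob p p (coordinate i @^-1` A) = p A.
Proof.
move=> mA; rewrite /coordinate; case: ifPn => _.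
  rewrite (_ : _ @^-1` _ = A `*` setT).
    by rewrite product_probE// probability_setT mule1.
  by apply/seteqP; split => w //= [].
rewrite (_ : _ @^-1` _ = setT `*` A).
  by rewrite product_probE// probability_setT mul1e.
by apply/seteqP; split => w //= [].
Qed.

Lemma iid_coordinate : iid coordinate (fun x => p `]-oo, x]%classic).
Proof.
split=> [A mA|i x]; last exact: coordinateE.
rewrite [RHS](eq_bigr (fun i => p (A i))); last by move=> i _; exact: coordinateE.
rewrite !big_ord_recl big_ord0 mule1 -product_probE//.
congr (product_prob p p _).
apply/seteqP; split => [w Aw|w [/= A0 A1] i].
  by split; [exact: (Aw ord0)|exact: (Aw (lift ord0 ord0))].
rewrite /coordinate; case: ifPn => [/eqP ->//|i0].
by have -> : i = lift ord0 ord0 by apply: val_inj => /=; case: i i0 => -[|[]].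
Qed.

Lemma sum_coordinate w : \sum_(i < 2) coordinate i w = w.1 + w.2.
Proof. by rewrite !big_ord_recl big_ord0 addr0. Qed.

(** The case [n = 2] of the definition, for the two coordinates of the plane. *)
Lemma law_in_J_single_big_jump : law_in_J p -> single_big_jump p.
Proof.
move=> [_ /(_ 2 isT _ _ _ _ iid_coordinate)].
move=> /(limf_einf_cvg1 (one_jump_ratio_le1 coordinate)
  (one_jump_ratio_nd coordinate)) nb.
apply: single_big_jumpP => // e e0; have [K rK] := nb _ e0; exists K.
apply: filterS rK => x.
have sE : [set w | x < \sum_(i < 2) coordinate i w] =
    [set w | x < w.1 + w.2].
  by apply/seteqP; split => w/=; rewrite sum_coordinate.
rewrite one_jump_ratio_ge sE; last first.
  exact: lt_le_trans (p_gt0 x) (tail_le_sum_tail _ _ _).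
rewrite -/(sum_tail p p x); congr (is_true (fine _ <= _)); congr (product_prob p p _).
apply/seteqP; split => w /=; rewrite sum_coordinate.
  by move=> [h ?]; split => //; [exact: (h ord0)|exact: (h (lift ord0 ord0))].
by move=> [? ? ?]; split => // i; rewrite /coordinate; case: ifP.
Qed.

End J_single_big_jump.

(** * Partial sums of an independent family *)

Lemma plane_measure_unique (R : realType)
    (m1 m2 : {measure set (R * R) -> \bar R}) : (m1 setT < +oo)%E ->
  (forall A B, measurable A -> measurable B -> m1 (A `*` B) = m2 (A `*` B)) ->
  forall E, measurable E -> m1 E = m2 E.
Proof.
move=> m1oo m12 E mE.
pose C : set (set (R * R)) :=
  [set C | exists A, measurable A /\ exists B, measurable B /\ C = A `*` B].
apply: (measure_unique C (fun=> setT)) => //.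
- rewrite measurable_prod_measurableType //; congr (<<s _ >>).
  rewrite predeqE; split => [[A mA [B mB <-]]|[A [mA [B [mB ->]]]]].
    by exists A; split => //; exists B.
  by exists A => //; exists B.
- move=> _ _ [X1 [mX1 [X2 [mX2 ->]]]] [Y1 [mY1 [Y2 [mY2 ->]]]].
  rewrite -setXI; exists (X1 `&` Y1); split; first exact: measurableI.
  by exists (X2 `&` Y2); split => //; exact: measurableI.
- by move=> _; exists setT; split => //; exists setT; rewrite setXTT.
- by rewrite bigcup_const.
- by move=> _ [A [mA [B [mB ->]]]]; exact: m12.
Qed.

Section partial_sums.
Context (R : realType) d (T : measurableType d) (P : probability T R) (n : nat).
Variable X : 'I_n -> {RV P >-> R}.
Hypothesis X_indep : mutually_independent X.

Definition partial_sum (k : nat) w := \sum_(i < n | (i < k)%N) X i w.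

Lemma measurable_partial_sum k : measurable_fun setT (partial_sum k).
Proof.
rewrite (_ : partial_sum k = fun w : T => \sum_(i < n) (if (i < k)%N then X i w else 0)).
  by apply: measurable_sum => i; case: (i < k)%N; [|exact: measurable_cst].
by apply/funext => w; rewrite /partial_sum big_mkcond.
Qed.

Definition partial_sum_RV k : {RV P >-> R} := rv_of P (measurable_partial_sum k).

Lemma partial_sum0 w : partial_sum 0 w = 0.
Proof. by rewrite /partial_sum big_pred0. Qed.

Lemma partial_sumS (k : 'I_n) w :
  partial_sum k.+1 w = partial_sum k w + X k w.
Proof.
rewrite /partial_sum (bigD1 k (P := fun i : 'I_n => (i < k.+1)%N))//= addrC; congr (_ + _).
by apply: eq_bigl => i; rewrite ltnS ltn_neqAle andbC.
Qed.

Lemma partial_sum_all w : partial_sum n w = \sum_(i < n) X i w.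
Proof. by apply: eq_bigl => i; rewrite ltn_ord. Qed.

Let later (A : 'I_n -> set R) (k : nat) :=
  [set w | forall i : 'I_n, (k <= i)%N -> A i (X i w)].

Let measurable_later A k : (forall i, measurable (A i)) -> measurable (later A k).
Proof.
move=> mA; rewrite (_ : later A k =
    \bigcap_(i in [set i : 'I_n | (k <= i)%N]) X i @^-1` A i).
  apply: fin_bigcap_measurable => // i _.
  by rewrite -[_ @^-1` _]setTI; exact: measurable_funP.
by [].
Qed.

(** By induction on [k]: under the restriction of the probability to an event on
    the variables after the [k]-th, the pair of the partial sum and the [k]-th
    variable has, up to a constant factor, its unrestricted law, since the two
    laws agree on rectangles. *)
Lemma partial_sum_indep (A : 'I_n -> set R) (B : set R) (k : nat) :
  (forall i, measurable (A i)) -> measurable B -> (k <= n)%N ->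
  P ([set w | B (partial_sum k w)] `&` later A k) =
  (P [set w | B (partial_sum k w)] *
   \prod_(i < n | (k <= i)%N) P (X i @^-1` A i))%E.
Proof.
move=> mA mB; elim: k A mA B mB => [A mA B mB _|k IH A mA B mB kn].
  have -> : later A 0 = [set w | forall i, A i (X i w)].
    by apply/seteqP; split => w h i; [exact: h|move=> _; exact: h].
  have [B0|B0] := pselect (B 0).
    have -> : [set w | B (partial_sum 0 w)] = setT.
      by apply/seteqP; split => w //= _; rewrite partial_sum0.
    by rewrite setTI probability_setT mul1e X_indep.
  have -> : [set w | B (partial_sum 0 w)] = set0.
    by apply/seteqP; split => w //=; rewrite partial_sum0.
  by rewrite set0I measure0 mul0e.
pose k' := Ordinal kn.
pose f w := (partial_sum k w, X k' w).
have mf : measurable_fun setT f.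
  by apply: measurable_fun_pair => //; exact: measurable_partial_sum.
have mfE E : measurable E -> measurable (f @^-1` E).
  by move=> mE; rewrite -[f @^-1` E]setTI; exact: mf.
pose G := later A k.+1.
have mG : measurable G by exact: measurable_later.
pose c := (\prod_(i < n | (k.+1 <= i)%N) P (X i @^-1` A i))%E.
have c0 : (0 <= c)%E by exact: prode_ge0.
have cfin : c \is a fin_num.
  apply: prode_fin_num => i _; apply: fin_num_measure.
  by rewrite -[_ @^-1` _]setTI; exact: measurable_funP.
have c0' : (0 <= fine c)%R by exact: fine_ge0.
pose r := NngNum c0'.
(* [c] is the probability of the event [G] on the later variables. *)
pose m1 := pushforward (mrestr P mG) f.
pose fRV : {mfun T >-> (R * R)%type} := HB.pack f (isMeasurableFun.Build _ _ _ _ f mf).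
pose m2 := mscale r (distribution P fRV).
have m12 E : measurable E -> m1 E = m2 E.
  apply: plane_measure_unique.
    rewrite /m1 -ge0_fin_numE// /pushforward /= /mrestr fin_num_measure//.
    by apply: measurableI => //; exact: mfE.
  move=> C D mC mD.
  rewrite /m1 /m2 /= /mrestr /mscale /distribution /pushforward /r /= fineK//.
  have rect A' : (forall i, measurable (A' i)) ->
      P (f @^-1` (C `*` D) `&` later A' k.+1) =
      (P [set w | C (partial_sum k w)] * (P (X k' @^-1` D) *
       \prod_(i < n | (k.+1 <= i)%N) P (X i @^-1` A' i)))%E.
    move=> mA'; pose AD i := if i == k' then D else A' i.
    have mAD i : measurable (AD i) by rewrite /AD; case: ifP.
    have := IH AD mAD C mC (ltnW kn).
    rewrite (bigD1 k')//= {2}/AD eqxx [in X in _ = X -> _](eq_big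
      (fun i : 'I_n => (k.+1 <= i)%N) (fun i => P (X i @^-1` A' i))).
    - move=> <-; congr (P _); apply/seteqP; split => w /=.
        move=> [[Cw Dw] h]; split => // i ki; rewrite /AD.
        case: eqP => [->//|/eqP ik]; apply: h.
        by rewrite ltn_neqAle ki andbT eq_sym; apply: contra ik => /eqP e; apply/eqP/val_inj.
      move=> [Cw h]; split; first split => //.
        by have := h k' (leqnn _); rewrite /AD eqxx.
      move=> i ki; have := h i (ltnW ki); rewrite /AD.
      by case: eqP ki => // ->; rewrite ltnn.
    - by move=> i; rewrite ltn_neqAle andbC eq_sym.
    - move=> i /andP[_ ik]; by rewrite /AD (negbTE ik).
  have fCD : P (f @^-1` (C `*` D)) =
      (P [set w | C (partial_sum k w)] * P (X k' @^-1` D))%E.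
    have := rect (fun=> setT) (fun=> measurableT).
    rewrite [X in _ `&` X](_ : _ = setT); last by apply/seteqP; split.
    rewrite setIT => ->; rewrite big1 ?mule1// => i _.
    by rewrite preimage_setT probability_setT.
  by rewrite rect// -/c muleA muleC; congr (_ * _)%E; rewrite -fCD.
have mE : measurable [set z : R * R | B (z.1 + z.2)].
  have : measurable_fun [set: R * R] (fun z : R * R => z.1 + z.2).
    exact: measurable_funD.
  by move=> /(_ measurableT _ mB); rewrite setTI.
have fB : f @^-1` [set z : R * R | B (z.1 + z.2)] =
    [set w | B (partial_sum k.+1 w)].
  by apply/seteqP; split => w /=; rewrite (partial_sumS k').
have := m12 _ mE.
rewrite /m1 /m2 /= /mrestr /mscale /distribution /pushforward /r /= fineK//.
by rewrite -fB -/G -/c muleC.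
Qed.

Lemma partial_sum_RV_indep (k : 'I_n) E : measurable E ->
  P [set w | E (partial_sum k w, X k w)] =
  product_prob (distribution P (partial_sum_RV k)) (distribution P (X k)) E.
Proof.
move=> mE; pose f w := (partial_sum k w, X k w).
have mf : measurable_fun setT f.
  by apply: measurable_fun_pair => //; exact: measurable_partial_sum.
rewrite -[LHS]/(pushforward P f E).
apply: plane_measure_unique => //.
  rewrite -ge0_fin_numE// /pushforward fin_num_measure//.
  by rewrite -[_ @^-1` _]setTI; exact: mf.
move=> A B mA mB.
transitivity (P [set w | A (partial_sum k w)] * P (X k @^-1` B))%E; last first.
  by apply/esym; exact: product_probE.
pose A' i := if i == k then B else setT.
have mA' i : measurable (A' i) by rewrite /A'; case: ifP.
have := partial_sum_indep mA' mA (ltnW (ltn_ord k)).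
rewrite (bigD1 k)//= big1 ?mule1; last first.
  by move=> i /andP[_ ik]; rewrite /A' (negbTE ik) preimage_setT probability_setT.
rewrite {2}/A' eqxx => <-; rewrite /pushforward/=; congr (P _).
apply/seteqP; split => w /= [Aw h]; split => //.
  by move=> i ki; rewrite /A'; case: eqP => // ->.
by have := h k (leqnn _); rewrite /A' eqxx.
Qed.

End partial_sums.

(** * From two copies to any number of terms *)

Section single_big_jump_J.
Context (R : realType) (p : probability R R).
Hypothesis p_ge0 : p `]-oo, 0[%classic = 0%E.
Hypothesis p_gt0 : forall x, 0 < tail p x.

Section iid_family.
Context d (T : measurableType d) (P : probability T R) (n : nat).
Variable X : 'I_n -> {RV P >-> R}.
Hypothesis X_iid : iid X (fun x => p `]-oo, x]%classic).

Let law (i : 'I_n) : probability R R := distribution P (X i).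
Let sum_law (k : nat) : probability R R := distribution P (partial_sum_RV X k).

Let law_cdf i x : law i `]-oo, x]%classic = p `]-oo, x]%classic.
Proof. exact: (proj2 X_iid). Qed.

Lemma iid_tail i x : tail (law i) x = tail p x.
Proof.
have tailE (q : probability R R) : tail q x = 1 - fine (q `]-oo, x]%classic).
  rewrite /tail -setCitvl probability_setC// fineB ?fin_num_measure//.
by rewrite !tailE law_cdf.
Qed.

(** The negative half-line is a union of closed rays, on which the laws of
    [X i] and [p] agree. *)
Lemma iid_ge0 i : law i `]-oo, 0[%classic = 0%E.
Proof.
apply/eqP; rewrite eq_le measure_ge0 andbT.
have small e : e < 0 -> law i `]-oo, e]%classic = 0%E.
  move=> e0; rewrite law_cdf; apply/eqP.
  rewrite eq_le measure_ge0 andbT -p_ge0 le_measure ?inE//.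
  by move=> z/=; rewrite !in_itv/= => /le_lt_trans; exact.
have -> : (`]-oo, 0[%classic : set R) =
    \bigcup_k `]-oo, (- k.+1%:R^-1)]%classic.
  apply/seteqP; split => z /=; last first.
    move=> [k _] /=; rewrite !in_itv/= => /le_lt_trans; apply.
    by rewrite oppr_lt0 invr_gt0.
  rewrite in_itv/= => z0; exists (Num.truncn (- z)^-1) => //=.
  rewrite in_itv/= lerNr invf_ple ?posrE// ?oppr_gt0//.
  by rewrite ltW// truncnS_gt.
apply: (le_trans (measure_sigma_subadditive _ _ _ (@subset_refl _ _))).
- by move=> k; exact: measurable_itv.
- by apply: bigcup_measurable => k _; exact: measurable_itv.
rewrite eseries0// => k _ _; apply: small.
by rewrite oppr_lt0 invr_gt0.
Qed.

Let iid_indep (k : 'I_n) E : measurable E ->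
  P [set w | E (partial_sum X k w, X k w)] =
  product_prob (sum_law k) (law k) E.
Proof. by move=> mE; exact: (partial_sum_RV_indep (proj1 X_iid)). Qed.

Let sum_lawS (k : 'I_n) x :
  tail (sum_law k.+1) x = sum_tail (sum_law k) (law k) x.
Proof.
rewrite /tail /sum_tail -iid_indep; last exact: measurable_sum_gt.
congr (fine (P _)); apply/seteqP; split => w /=;
  by rewrite in_itv/= andbT (partial_sumS X k).
Qed.

Let sum_tail_ge k x : (0 < k <= n)%N -> tail p x <= tail (sum_law k) x.
Proof.
case: k => // k; elim: k => [|k IH] kn.
  rewrite (sum_lawS (Ordinal kn)) /sum_tail -iid_indep; last exact: measurable_sum_gt.
  rewrite -(iid_tail (Ordinal kn)) le_eqVlt; apply/orP; left; apply/eqP.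
  congr (fine (P _)); apply/seteqP; split => w /=;
  by rewrite in_itv/= andbT partial_sum0 add0r.
apply: (le_trans (IH (ltnW kn))); rewrite (sum_lawS (Ordinal kn)).
by apply: tail_le_sum_tail; exact: iid_ge0.
Qed.

Hypothesis p_single : single_big_jump p.

Let p_shift : shift_bounded p := single_big_jump_shift_bounded p_ge0 p_gt0 p_single.

(** A sum of independent terms exceeds [x] with a probability comparable to
    the tail of one term: when both the partial sum and the next term exceed
    [K], exchange the law of the partial sum for [p]; otherwise shift. *)
Let sum_tail_dominated k : (0 < k <= n)%N -> tail_dominated (sum_law k) p.
Proof.
case: k => // k; elim: k => [|k IH] kn.
  exists 1; rewrite ?ltr01//; apply: nearW => x.
  rewrite (sum_lawS (Ordinal kn)) /sum_tail -iid_indep; last exact: measurable_sum_gt.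
  rewrite mul1r -(iid_tail (Ordinal kn)) le_eqVlt; apply/orP; left; apply/eqP.
  congr (fine (P _)); apply/seteqP; split => w /=;
  by rewrite in_itv/= andbT partial_sum0 add0r.
have [C C0 kp] := IH (ltnW kn).
have [K sK] := p_single ltr01.
have [L KL kpL] := near_pinfty_ex K kp.
have [C' C'0 sL] := p_shift L.
exists (C + (C * C' + C')); first by rewrite !addr_gt0 ?mulr_gt0.
near=> x; rewrite (sum_lawS (Ordinal kn)).
apply: (le_trans (sum_tail_le _ _ L x)).
rewrite iid_tail.
have sx : tail p (x - L) <= C' * tail p x by near: x.
have kx : tail (sum_law k.+1) (x - L) <= C * tail p (x - L).
  by near: x; exact: (near_pinfty_shift (- L) kp).
have bx : both_exceed (sum_law k.+1) (law (Ordinal kn)) L x <= C * tail p x.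
  rewrite both_exceedC.
  apply: (le_trans (both_exceed_dominated_ray (law (Ordinal kn)) _ kpL)).
  rewrite ler_pM2l// both_exceedC.
  apply: (@le_trans _ _ (1 * both_exceed p p L x)).
    by apply: both_exceed_dominated_ray => y _; rewrite iid_tail mul1r.
  rewrite mul1r (le_trans (both_exceed_noninc _ _ _ KL))// -[leRHS]mul1r.
  by near: x.
have : C * tail p (x - L) <= C * (C' * tail p x) by rewrite ler_pM2l.
by move: bx kx sx; rewrite !mulrDl -!mulrA; lra.
Unshelve. all: by end_near.
Qed.

Let no_jump k K x := [set w | (forall i : 'I_n, (i < k)%N -> X i w <= x - K) /\
  x < partial_sum X k w].

Let measurable_no_jump_k k K x : measurable (no_jump k K x).
Proof.
rewrite (_ : no_jump k K x =
    (\bigcap_(i in [set i : 'I_n | (i < k)%N]) X i @^-1` `]-oo, x - K]) `&`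
    partial_sum_RV X k @^-1` `]x, +oo[).
  apply: measurableI; last first.
    by rewrite -[_ @^-1` _]setTI; exact: measurable_funP.
  apply: fin_bigcap_measurable => // i _.
  by rewrite -[_ @^-1` _]setTI; exact: measurable_funP.
by apply/seteqP; split => w /=; rewrite in_itv/= andbT => -[h xS].
Qed.

Let no_jump_noninc k K L x : K <= L ->
  fine (P (no_jump k L x)) <= fine (P (no_jump k K x)).
Proof.
move=> KL; apply: fine_measure_le => // w [h xS]; split => // i ik.
by rewrite (le_trans (h i ik))// lerD2l lerN2.
Qed.

(** Either the partial sum and the next term both exceed [K], or the next term
    is at most [K] and the partial sum alone has no big jump; if it is the
    partial sum that is at most [K], the next term is itself a big jump. *)
Let no_jump_small k : (0 < k <= n)%N -> forall e, 0 < e -> exists K,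
  \forall x \near +oo, fine (P (no_jump k K x)) <= e * tail p x.
Proof.
case: k => // k; elim: k => [|k IH] kn e e0.
  exists 0; apply: nearW => x.
  rewrite (_ : no_jump _ _ _ = set0); first by rewrite measure0/= mulr_ge0 ?tail_ge0 ?ltW.
  apply/seteqP; split => w //= [] /(_ (Ordinal kn) isT).
  by rewrite (partial_sumS X (Ordinal kn)) partial_sum0 add0r subr0; lra.
have [C C0 kp] := sum_tail_dominated (ltnW kn : (0 < k.+1 <= n)%N).
have [K sK] := p_single (divr_gt0 (divr_gt0 e0 (ltr0Sn R 1)) C0).
have [L KL kpL] := near_pinfty_ex K kp.
have [C' C'0 sL] := p_shift L.
have [M nM] := IH (ltnW kn) _ (divr_gt0 (divr_gt0 e0 (ltr0Sn R 1)) C'0).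
pose M' := Num.max 0 M.
exists (L + M'); near=> x.
pose f w := (partial_sum X k.+1 w, X (Ordinal kn) w).
have mf : measurable_fun setT f.
  by apply: measurable_fun_pair => //; exact: measurable_partial_sum.
have mE : measurable (f @^-1` exceed_set L x).
  by rewrite -[_ @^-1` _]setTI; apply: mf => //; exact: measurable_exceed.
apply: (@le_trans _ _ (fine (P (f @^-1` exceed_set L x)) +
    fine (P (no_jump k.+1 M' (x - L))))).
  apply: fine_measure_leU => // w [h]; rewrite (partial_sumS X (Ordinal kn)) => xS.
  case: (ltP L (X (Ordinal kn) w)) => LX.
    case: (ltP L (partial_sum X k.+1 w)) => LS; first by left.
    have M'0 : 0 <= M' by rewrite le_max lexx.
    by have := h (Ordinal kn) (ltnSn _); lra.
  right; split; last by rewrite /= in xS; lra.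
  move=> i ik; have := h i (ltnW ik); lra.
have bx : fine (P (f @^-1` exceed_set L x)) <= e / 2 * tail p x.
  have -> : fine (P (f @^-1` exceed_set L x)) =
      both_exceed (sum_law k.+1) (law (Ordinal kn)) L x.
    by congr fine; exact: (iid_indep (Ordinal kn) (measurable_exceed L x)).
  rewrite both_exceedC.
  apply: (le_trans (both_exceed_dominated_ray (law (Ordinal kn)) _ kpL)).
  have -> : e / 2 * tail p x = C * (e / 2 / C * tail p x).
    by field; rewrite gt_eqF.
  rewrite ler_pM2l// both_exceedC.
  apply: (@le_trans _ _ (1 * both_exceed p p L x)).
    by apply: both_exceed_dominated_ray => y _; rewrite iid_tail mul1r.
  rewrite mul1r (le_trans (both_exceed_noninc _ _ _ KL))//.
  by near: x.
have nx : fine (P (no_jump k.+1 M' (x - L))) <= e / 2 * tail p x.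
  have -> : e / 2 * tail p x = e / 2 / C' * (C' * tail p x).
    by field; rewrite gt_eqF.
  apply: (@le_trans _ _ (e / 2 / C' * tail p (x - L))).
    apply: (@le_trans _ _ (fine (P (no_jump k.+1 M (x - L))))).
      by apply: no_jump_noninc; rewrite le_max lexx orbT.
    by near: x; exact: (near_pinfty_shift (- L) nM).
  by rewrite ler_pM2l ?divr_gt0//; near: x.
lra.
Unshelve. all: by end_near.
Qed.

Lemma iid_one_jump : (0 < n)%N ->
  limf_einf (fun x : R => (one_jump_ratio X K x)%:E) +oo
    @[K --> +oo] --> 1%E.
Proof.
move=> n0; apply/limf_einf_cvg1.
- exact: one_jump_ratio_le1.
- exact: one_jump_ratio_nd.
have nn : (0 < n <= n)%N by rewrite n0 leqnn.
move=> e e0; have [K nK] := no_jump_small nn e0; exists K.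
apply: filterS nK => x nx.
have sumE : fine (P [set w | x < \sum_(i < n) X i w]) = tail (sum_law n) x.
  congr (fine (P _)); apply/seteqP; split => w/=;
  by rewrite in_itv/= andbT partial_sum_all.
rewrite one_jump_ratio_ge sumE; last exact: lt_le_trans (p_gt0 x) (sum_tail_ge _ nn).
have -> : [set w | (forall i, X i w <= x - K) /\ x < \sum_(i < n) X i w] =
    no_jump n K x.
  apply/seteqP; split => w /= [h xS].
    by split; [move=> i _; exact: h|rewrite partial_sum_all].
  by split; [move=> i; exact: h|rewrite -partial_sum_all].
by rewrite (le_trans nx)// ler_pM2l// sum_tail_ge.
Qed.

End iid_family.

Lemma single_big_jump_law_in_J : single_big_jump p -> law_in_J p.
Proof.
move=> sp; split; last first.
  move=> n n2 d T P X X_iid; apply: iid_one_jump => //.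
  exact: leq_trans n2.
have mX : measurable_fun [set: R] (Num.max (0 : R)).
  exact: measurable_maxr.
exists _, _, p, (rv_of p mX); split => [w|x|x].
- by rewrite /= le_max lexx.
- apply: (@lt_le_trans _ _ (tail p x)%:E); first by rewrite lte_fin.
  rewrite EFin_tail /ccdf /distribution/= /pushforward le_measure ?inE//.
    by rewrite -[_ @^-1` _]setTI; exact: mX.
  by move=> z /=; rewrite !in_itv/= !andbT => xz; rewrite lt_max xz orbT.
rewrite /cdf /distribution/= /pushforward.
have [x0|x0] := leP 0 x.
  congr (p _); apply/seteqP; split => z /=; rewrite !in_itv/= ge_max x0//.
rewrite (_ : _ @^-1` _ = set0).
  rewrite measure0; apply/esym/eqP; rewrite eq_le measure_ge0 andbT -p_ge0.
  rewrite le_measure ?inE//.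
  by move=> z/=; rewrite !in_itv/= => /le_lt_trans; exact.
apply/seteqP; split => z //=; rewrite in_itv/= ge_max => /andP[].
by rewrite leNgt x0.
Qed.

Lemma law_in_JP : law_in_J p <-> single_big_jump p.
Proof.
split; last exact: single_big_jump_law_in_J.
exact: law_in_J_single_big_jump.
Qed.

End single_big_jump_J.

(** * Uniqueness of the Laplace transform *)

Section laplace_uniqueness.
Context (R : realType).
Implicit Types (m : {measure set R -> \bar R}) (t x : R).

Lemma bernoulli_ineq (y : R) n : 0 <= y <= 1 -> 1 - n%:R * y <= (1 - y) ^+ n.
Proof.
move=> /andP[y0 y1]; elim: n => [|n IH]; first by rewrite mul0r subr0 expr0.
rewrite exprS; apply: (@le_trans _ _ ((1 - y) * (1 - n%:R * y))).
  rewrite -natr1; have : 0 <= n%:R * y * y by rewrite !mulr_ge0.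
  by lra.
by rewrite ler_wpM2l// subr_ge0.
Qed.

(** A polynomial in [expR (- s * t)], with [s = N + 1], that approximates the
    indicator of the ray beyond [x]: up to the integer part it is the
    distribution function at [t] of the maximum of [s * expR (s * x)]
    exponential variables of rate [s], whose location is close to [x]. *)
Definition gumbel_exponent x (N : nat) : nat :=
  Num.truncn (N.+1%:R * expR (N.+1%:R * x)).

Definition gumbel x (N : nat) t : R :=
  (1 - expR (- (N.+1%:R * t))) ^+ gumbel_exponent x N.

Lemma expRN_ge0_le1 (s t : R) : 0 <= s -> 0 <= t -> 0 <= expR (- (s * t)) <= 1.
Proof. by move=> s0 t0; rewrite expR_ge0 -expR0 ler_expR oppr_le0 mulr_ge0. Qed.

Lemma onem_expRN_ge0_le1 (s t : R) : 0 <= s -> 0 <= t ->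
  0 <= 1 - expR (- (s * t)) <= 1.
Proof. by move=> s0 t0; have := expRN_ge0_le1 s0 t0; lra. Qed.

Lemma gumbel_ge0_le1 x N t : 0 <= t -> 0 <= gumbel x N t <= 1.
Proof.
move=> t0; have /andP[a0 a1] := onem_expRN_ge0_le1 (ler0n R N.+1) t0.
by rewrite /gumbel exprn_ge0//= exprn_ile1.
Qed.

(** The value at [t] behaves like [exp (- s * exp (s * (x - t)))] with
    [s = N + 1]; the factor [s] in the exponent makes it vanish at [t = x]
    as well, so that the limit is the indicator of an open ray. *)
Lemma gumbel_cvg x t : 0 <= t ->
  gumbel x N t @[N --> \oo] --> (\1_(`]x, +oo[%classic) t : R).
Proof.
move=> t0.
suff [c hc] : exists c : R, forall N,
    `|(\1_(`]x, +oo[%classic) t : R) - gumbel x N t| <= c * N.+1%:R^-1.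
  have h : c * N.+1%:R^-1 @[N --> \oo] --> (0 : R).
    rewrite -[X in _ --> X](mulr0 c).
    by apply: cvgM; [exact: cvg_cst|exact: cvg_harmonic].
  apply/cvgrPdist_le => e e0.
  move/cvgrPdist_le : h => /(_ _ e0); apply: filterS => N.
  rewrite sub0r normrN => /(le_trans _); apply.
  by rewrite (le_trans (hc N))// ler_norm.
have sgt0 N : 0 < N.+1%:R :> R by rewrite ltr0n.
have [tx|xt] := leP t x.
  exists 1 => N; rewrite indicE memNset ?mulr0n; last first.
    by rewrite /= in_itv/= andbT => /lt_le_trans/(_ tx); rewrite ltxx.
  rewrite sub0r normrN mul1r ger0_norm; last by have /andP[] := gumbel_ge0_le1 x N t0.
  set s : R := N.+1%:R; set y := expR (- (s * t)).
  have /andP[y0 y1] : 0 <= y <= 1 by apply: expRN_ge0_le1 => //; exact: ltW.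
  have ny : N%:R <= (gumbel_exponent x N)%:R * y.
    have le1 : s * expR (s * x) - 1 <= (gumbel_exponent x N)%:R.
      by rewrite lerBlDr natr1 ltW// truncnS_gt.
    apply: (@le_trans _ _ ((s * expR (s * x) - 1) * y)); last by rewrite ler_wpM2r.
    have sx : 1 <= expR (s * x) * y.
      by rewrite -expRD -[leLHS]expR0 ler_expR -mulrBr mulr_ge0 ?subr_ge0// ltW.
    have h1 : s <= s * expR (s * x) * y by rewrite -mulrA ler_peMr// ltW.
    have h2 : s = N%:R + 1 by rewrite natr1.
    by rewrite mulrBl mul1r; lra.
  apply: (@le_trans _ _ (expR (- y) ^+ gumbel_exponent x N)).
    rewrite /gumbel -/s -/y lerXn2r ?nnegrE ?expR_ge0 ?subr_ge0//.
    exact: expR_ge1Dx.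
  rewrite -expRM_natl mulrN expRN lef_pV2 ?posrE ?expR_gt0//.
  apply: (@le_trans _ _ (expR N%:R)); last by rewrite ler_expR.
  by rewrite /s -natr1 addrC expR_ge1Dx.
pose dd := (t - x) / 2; have dd0 : 0 < dd by rewrite divr_gt0// subr_gt0.
(* From [expR (2 * z) >= z ^ 2] with [z = s * dd]. *)
exists (dd ^- 2) => N; rewrite indicE mem_set ?mulr1n; last first.
  by rewrite /= in_itv/= andbT.
rewrite ger0_norm; last by have /andP[] := gumbel_ge0_le1 x N t0; rewrite subr_ge0.
set s : R := N.+1%:R; set y := expR (- (s * t)).
have y01 : 0 <= y <= 1 by apply: expRN_ge0_le1 => //; exact: ltW.
have := bernoulli_ineq (gumbel_exponent x N) y01.
rewrite /gumbel -/s -/y => h.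
suff : (gumbel_exponent x N)%:R * y <= dd ^- 2 * s^-1 by move=> h'; rewrite lerBlDl -lerBlDr (le_trans _ h)// lerD2l lerN2.
have ts : (gumbel_exponent x N)%:R <= s * expR (s * x).
  by rewrite truncn_le// mulr_ge0 ?expR_ge0// ltW.
apply: (@le_trans _ _ (s * expR (s * x) * y)).
  by rewrite ler_wpM2r//; case/andP: y01.
rewrite -mulrA -expRD.
have -> : s * x - s * t = - (2%:R * (s * dd)) by rewrite /dd; field.
rewrite expRN expRM_natl.
have sd : 0 < s * dd by rewrite mulr_gt0.
have e1 : (s * dd) ^+ 2 <= expR (s * dd) ^+ 2.
  rewrite lerXn2r ?nnegrE ?expR_ge0 ?ltW//.
  by apply: lt_le_trans (expR_ge1Dx _); rewrite ltrDr.
apply: (@le_trans _ _ (s * (s * dd) ^- 2)).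
  by rewrite ler_pM2l// lef_pV2 ?posrE ?exprn_gt0 ?expR_gt0.
rewrite le_eqVlt; apply/orP; left; apply/eqP.
by field; rewrite !gt_eqF.
Qed.

Lemma measurable_expRN (s : R) : measurable_fun setT (fun t : R => expR (- (s * t))).
Proof.
apply: measurableT_comp; first exact: measurable_expR.
by apply: measurableT_comp => //; exact: measurable_funM.
Qed.

Lemma measurable_gumbel_term (s a : R) n :
  measurable_fun setT (fun t : R => (1 - expR (- (s * t))) ^+ n * expR (- (a * t))).
Proof.
apply: measurable_funM; last exact: measurable_expRN.
apply: measurable_funX; apply: measurable_funB => //.
exact: measurable_expRN.
Qed.

Lemma gumbel_term_ge0_le1 (s a t : R) n : 0 <= s -> 0 <= a -> 0 <= t ->
  0 <= (1 - expR (- (s * t))) ^+ n * expR (- (a * t)) <= 1.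
Proof.
move=> s0 a0 t0.
have /andP[b0 b1] := onem_expRN_ge0_le1 s0 t0.
have /andP[c0 c1] := expRN_ge0_le1 a0 t0.
by rewrite mulr_ge0 ?exprn_ge0//= mulr_ile1 ?exprn_ge0// exprn_ile1.
Qed.

Lemma negative_null_setI m A : m `]-oo, 0[%classic = 0%E -> measurable A ->
  m A = m (A `&` `[0, +oo[%classic).
Proof.
move=> m0 mA; rewrite -[in LHS](setIT A) -(setvU `[0, +oo[%classic) setIUr.
rewrite measureU//; last 3 first.
- by apply: measurableI => //; exact: measurableC.
- exact: measurableI.
- by rewrite setIACA setICl setI0.
rewrite [X in (X + _)%E](_ : _ = 0%E) ?add0e//.
apply: subset_measure0 m0 => //.
  by apply: measurableI => //; exact: measurableC.
by rewrite setCitvr; apply: subIset; right.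
Qed.

(** Two finite measures with the same Laplace transform at the integers give
    the same integral to every polynomial in [expR (- t)], in particular to
    those approximating the indicator of a ray. *)
Lemma laplace_unique m1 m2 :
  (m1 setT < +oo)%E -> (m2 setT < +oo)%E ->
  m1 `]-oo, 0[%classic = 0%E -> m2 `]-oo, 0[%classic = 0%E ->
  (forall n : nat,
    (\int[m1]_(t in `[0%R, +oo[%classic) (expR (- (n%:R * t)))%:E =
     \int[m2]_(t in `[0%R, +oo[%classic) (expR (- (n%:R * t)))%:E)%E) ->
  forall A, measurable A -> m1 A = m2 A.
Proof.
move=> m1oo m2oo m10 m20 m12.
have le_total m A : measurable A -> (m setT < +oo)%E -> (m A < +oo)%E.
  by move=> mA; apply: le_lt_trans; rewrite le_measure ?inE.
have D0 t : (`[0, +oo[%classic : set R) t -> 0 <= t by rewrite /= in_itv/= andbT.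
have term_ge0 (s a : nat) n t : (`[0, +oo[%classic : set R) t ->
    (0%:E <= ((1 - expR (- (s%:R * t))) ^+ n * expR (- (a%:R * t)))%:E :> \bar R)%E.
  by move=> /D0 t0; rewrite lee_fin; have /andP[] :=
    gumbel_term_ge0_le1 n (ler0n R s) (ler0n R a) t0.
have term_fin m (s a : nat) n : (m setT < +oo)%E -> (\int[m]_(t in `[0%R, +oo[%classic)
    ((1 - expR (- (s%:R * t))) ^+ n * expR (- (a%:R * t)))%:E)%E \is a fin_num.
  move=> moo; rewrite ge0_fin_numE; last by apply: integral_ge0 => t; exact: term_ge0.
  apply: (@le_lt_trans _ _ (\int[m]_(t in `[0%R, +oo[%classic) (cst 1%:E) t)%E).
    apply: ge0_le_integral => //.
    - by move=> t; exact: term_ge0.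
    - by apply/measurable_EFinP/measurable_funTS; exact: measurable_gumbel_term.
    - move=> t /D0 t0; rewrite lee_fin.
      by have /andP[] := gumbel_term_ge0_le1 n (ler0n R s) (ler0n R a) t0.
  by rewrite integral_cst// mul1e le_total.
have term12 (s n a : nat) : (\int[m1]_(t in `[0%R, +oo[%classic)
      ((1 - expR (- (s%:R * t))) ^+ n * expR (- (a%:R * t)))%:E =
    \int[m2]_(t in `[0%R, +oo[%classic)
      ((1 - expR (- (s%:R * t))) ^+ n * expR (- (a%:R * t)))%:E)%E.
  elim: n a => [a|n IH a].
    under eq_integral do rewrite expr0 mul1r.
    by under [RHS]eq_integral do rewrite expr0 mul1r.
  have split m : (\int[m]_(t in `[0%R, +oo[%classic)
      ((1 - expR (- (s%:R * t))) ^+ n * expR (- (a%:R * t)))%:E =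
    \int[m]_(t in `[0%R, +oo[%classic)
      ((1 - expR (- (s%:R * t))) ^+ n.+1 * expR (- (a%:R * t)))%:E +
    \int[m]_(t in `[0%R, +oo[%classic)
      ((1 - expR (- (s%:R * t))) ^+ n * expR (- ((a + s)%:R * t)))%:E)%E.
    rewrite -ge0_integralD//.
    - apply: eq_integral => t _; rewrite -EFinD; congr EFin.
      rewrite natrD mulrDl opprD expRD exprS.
      by set u := expR _; set v := expR _; set w := _ ^+ n; ring.
    - by move=> t; exact: term_ge0.
    - by apply/measurable_EFinP/measurable_funTS; exact: measurable_gumbel_term.
    - by move=> t; exact: term_ge0.
    - by apply/measurable_EFinP/measurable_funTS; exact: measurable_gumbel_term.
  have := IH a; rewrite (split m1) (split m2) (IH (a + s)%N).
  set I := (X in (_ + X)%E) => /(congr1 (fun y => (y - I)%E)).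
  by rewrite !addeK ?term_fin.
have ray_cvg m x : (m setT < +oo)%E -> (\int[m]_(t in `[0%R, +oo[%classic) (gumbel x N t)%:E)%E
    @[N --> \oo] --> m (`]x, +oo[%classic `&` `[0, +oo[%classic).
  move=> moo; rewrite -integral_indic//.
  have [|||||_ _] := @dominated_convergence _ _ _ m `[0, +oo[%classic (measurable_itv _)
    (fun N t => (gumbel x N t)%:E) (fun t => (\1_(`]x, +oo[%classic) t)%:E)
    (cst 1%E).
  - move=> N; apply/measurable_EFinP/measurable_funTS.
    have := measurable_gumbel_term N.+1%:R 0 (gumbel_exponent x N).
    by under eq_fun do rewrite mul0r oppr0 expR0 mulr1.
  - by apply/measurable_EFinP/measurable_funTS; exact: measurable_indic.
  - apply: aeW => t /D0 t0; apply: cvg_EFin; first exact: nearW.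
    exact: gumbel_cvg.
  - apply/integrableP; split; first exact: measurable_cst.
    rewrite (eq_integral (cst 1%E)); last by move=> t _; rewrite /= normr1.
    by rewrite integral_cst// mul1e le_total.
  - apply: aeW => t N /D0 t0; rewrite /= lee_fin ger0_norm;
      by have /andP[] := gumbel_ge0_le1 x N t0.
  by [].
have ray12 x : m1 `]x, +oo[%classic = m2 `]x, +oo[%classic.
  rewrite (negative_null_setI m10)// (negative_null_setI m20)//.
  have := ray_cvg m1 x m1oo.
  have -> : (fun N => \int[m1]_(t in `[0%R, +oo[%classic) (gumbel x N t)%:E)%E =
            (fun N => \int[m2]_(t in `[0%R, +oo[%classic) (gumbel x N t)%:E)%E.
    apply/funext => N; have := term12 N.+1 (gumbel_exponent x N) 0.
    under eq_integral do rewrite mul0r oppr0 expR0 mulr1.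
    by under [X in _ = X -> _]eq_integral do rewrite mul0r oppr0 expR0 mulr1.
  by move=> h; have := cvg_unique _ h (ray_cvg m2 x m2oo); apply.
move=> A; apply: (measure_unique (@RGenOInfty.G R)
  (fun k => `](- k%:R)%R, +oo[%classic)).
- exact: RGenOInfty.measurableE.
- move=> _ _ [x ->] [y ->]; exists (Num.max x y).
  by apply/seteqP; split => z /=; rewrite !in_itv/= !andbT gt_max => /andP.
- by move=> k; exists (- k%:R).
- apply/seteqP; split => // z _; exists (Num.truncn `|z|).+1 => //=.
  rewrite in_itv/= andbT ltrNl (le_lt_trans _ (truncnS_gt _))//.
  by rewrite -normrN ler_norm.
- by move=> _ [x ->]; exact: ray12.
- by move=> k; exact: le_total.
Qed.

End laplace_uniqueness.

(** * Measures with a density, and Levy measures *)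

Section density_measure.
Context d (T : measurableType d) (R : realType) (m : {measure set T -> \bar R}).
Variable w : T -> R.
Hypotheses (w0 : forall t, 0 <= w t) (mw : measurable_fun setT w).

(** The side conditions are arguments so that the term alone determines the
    measure structure. *)
Definition density of (forall t, 0 <= w t) & measurable_fun setT w :=
  fun A : set T => (\int[m]_(t in A) (w t)%:E)%E.

Let density0 : density w0 mw set0 = 0%E.
Proof. exact: integral_set0. Qed.

Let density_ge0 A : (0 <= density w0 mw A)%E.
Proof. by apply: integral_ge0 => t _; rewrite lee_fin. Qed.

Let density_sigma_additive : semi_sigma_additive (density w0 mw).
Proof.
move=> F mF tF mUF; rewrite /density ge0_integral_bigcup//; last 2 first.
- by apply/measurable_EFinP; exact: measurable_funTS.
- by move=> t _; rewrite lee_fin.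
apply: is_cvg_ereal_nneg_natsum => n _.
by apply: integral_ge0 => t _; rewrite lee_fin.
Qed.

HB.instance Definition _ := isMeasure.Build _ _ _ (density w0 mw)
  density0 density_ge0 density_sigma_additive.

Import HBNNSimple.

Let integral_density_nnsfun (f : {nnsfun T >-> R}) :
  (\int[density w0 mw]_t (f t)%:E = \int[m]_t (f t * w t)%:E)%E.
Proof.
under [LHS]eq_integral do rewrite fimfunE -fsumEFin//.
rewrite [LHS]ge0_integral_fsum//; last 2 first.
- by move=> y; exact/measurable_EFinP/measurable_funM.
- by move=> y x _; rewrite nnfun_muleindic_ge0.
under [RHS]eq_integral => t _.
  rewrite EFinM fimfunE -fsumEFin// muleC ge0_mule_fsumr; last first.
    by move=> y; rewrite nnfun_muleindic_ge0.
  over.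
rewrite [RHS]ge0_integral_fsum//; last 2 first.
- move=> y; apply: emeasurable_funM; first exact/measurable_EFinP.
  exact/measurable_EFinP/measurable_funM.
- move=> y x _; rewrite mule_ge0//; first by rewrite lee_fin.
  by rewrite EFinM nnfun_muleindic_ge0.
apply: eq_fsbigr => r _.
rewrite integralZl_indic_nnsfun// integral_indic// setIT.
have [r0|r0] := leP 0 r; last first.
  rewrite preimage_nnfun0//= measure0 mule0 integral0_eq// => t _.
  by rewrite indicE in_set0 mulr0 mule0.
rewrite /= /density [X in (_ * X)%E]integral_mkcond -ge0_integralZl//; last 2 first.
- apply: (iffLR (measurable_restrictT (fun t => (w t)%:E) _)) => //.
  by apply/measurable_EFinP; exact: measurable_funTS.
- by move=> t _; rewrite erestrict_ge0// => x _; rewrite lee_fin.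
apply: eq_integral => t _; rewrite patchE indicE; case: ifPn => tr.
  by rewrite mulr1 muleC.
by rewrite mulr0 !mule0.
Qed.

Lemma ge0_integral_density (f : T -> \bar R) : measurable_fun setT f ->
  (forall t, 0 <= f t)%E ->
  (\int[density w0 mw]_t f t = \int[m]_t (f t * (w t)%:E))%E.
Proof.
move=> mf f0; pose f_ := nnsfun_approx measurableT mf.
transitivity (limn (fun n => \int[density w0 mw]_t (f_ n t)%:E)%E).
  rewrite -monotone_convergence//.
  - apply: eq_integral => y _; apply/esym/cvg_lim => //.
    by apply: cvg_nnsfun_approx => // *; exact: f0.
  - by move=> n; exact/measurable_EFinP.
  - by move=> n y _; rewrite lee_fin.
  - by move=> y _ a b ab; rewrite lee_fin; exact/lefP/nd_nnsfun_approx.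
under eq_fun do rewrite integral_density_nnsfun.
rewrite -monotone_convergence//.
- apply: eq_integral => y _; apply/cvg_lim => //.
  under eq_fun do rewrite EFinM.
  apply: cvgeZr => //.
  by apply: cvg_nnsfun_approx => // *; exact: f0.
- by move=> n; apply/measurable_EFinP/measurable_funM.
- by move=> n y _; rewrite lee_fin mulr_ge0.
- move=> y _ a b ab; rewrite lee_fin ler_wpM2r//.
  exact/lefP/nd_nnsfun_approx.
Qed.

End density_measure.

Section levy_sigma_finite.
Context (R : realType) (nu : {measure set R -> \bar R}).
Hypothesis levy_nu : levy_measure nu.

(** [min 1 x] is at least [min 1 t] on the ray beyond [t]. *)
Lemma levy_ray_lty t : 0 < t -> (nu `]t, +oo[%classic < +oo)%E.
Proof.
move=> t0; have [_ _] := levy_nu; set I := integral _ _ _ => Ioo.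
have c0 : 0 < Num.min 1 t by rewrite lt_min ltr01.
have cI : ((Num.min 1 t)%:E * nu `]t, +oo[%classic <= I)%E.
  rewrite -integral_cst//; apply: (@le_trans _ _
    (\int[nu]_(x in `]t, +oo[%classic) (Num.min 1 x)%:E)%E).
    apply: ge0_le_integral => //.
    - by move=> x _; rewrite lee_fin ltW.
    - by apply/measurable_EFinP/measurable_funTS/measurable_minr.
    - move=> x /=; rewrite in_itv/= andbT => tx; rewrite lee_fin.
      by rewrite le_min !ge_min lexx/= (ltW tx) orbT.
  apply: ge0_subset_integral => //.
  - by apply/measurable_EFinP/measurable_funTS/measurable_minr.
  - by move=> x /=; rewrite in_itv/= andbT lee_fin le_min ler01/= => /ltW.
  - exact: ray_subset (ltW t0).
move: cI Ioo; case: (nu `]t, +oo[%classic) (measure_ge0 nu `]t, +oo[%classic) => //=.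
  by move=> r _ _ _; exact: ltry.
by move=> _; rewrite mulry gtr0_sg// mul1e => /le_lt_trans h /h; rewrite ltxx.
Qed.

(** The Levy measure itself, under a name that carries the proof of its
    sigma-finiteness. *)
Definition levy_sigma of levy_measure nu : set R -> \bar R := nu.

HB.instance Definition _ := Measure.on (levy_sigma levy_nu).

Let levy_sigma_sigma_finite : sigma_finite setT (levy_sigma levy_nu).
Proof.
exists (fun k => `]-oo, 0] `|` `]k.+1%:R^-1, +oo[) => [|k].
  apply/seteqP; split => // x _; have [x0|x0] := leP x 0.
    by exists 0%N => //; left; rewrite /= in_itv.
  exists (Num.truncn x^-1) => //; right; rewrite /= in_itv/= andbT.
  by rewrite invf_plt ?posrE// truncnS_gt.
split; first exact: measurableU.
rewrite /levy_sigma.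
apply: le_lt_trans (measureU2 nu _ _) _; [exact: measurable_itv..|].
apply: lte_add_pinfty; last by apply: levy_ray_lty; rewrite invr_gt0.
have [nu0 _ _] := levy_nu.
exact: (eq_ind_r (fun y => (y < +oo)%E) (ltry (0 : R)) nu0).
Qed.

HB.instance Definition _ :=
  Measure_isSigmaFinite.Build _ _ _ (levy_sigma levy_nu) levy_sigma_sigma_finite.

End levy_sigma_finite.

(** * The derivative of the Laplace identity *)

Lemma ID_plus_levy (R : realType) (mu : probability R R)
  (nu : {measure set R -> \bar R}) : ID_plus mu nu -> levy_measure nu.
Proof. by case. Qed.

Section laplace_derivative.
Context (R : realType).
Implicit Types (s t h y : R).

Lemma mul_expRN_le y : y * expR (- y) <= 1 - expR (- y).
Proof.
rewrite lerBrDr -[X in _ + X]mul1r -mulrDl expRN ler_pdivrMr ?expR_gt0// mul1r addrC.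
exact: expR_ge1Dx.
Qed.

Lemma onem_expRN_le y : 1 - expR (- y) <= y.
Proof. by have := expR_ge1Dx (- y); lra. Qed.

Definition laplace_quotient s (k : nat) t :=
  (expR (- (s * t)) - expR (- ((s + k.+1%:R^-1) * t))) / k.+1%:R^-1.

Lemma laplace_quotientE s k t : laplace_quotient s k t =
  expR (- (s * t)) * ((1 - expR (- (k.+1%:R^-1 * t))) / k.+1%:R^-1).
Proof. by rewrite /laplace_quotient (mulrDl s) opprD expRD mulrA mulrBr mulr1. Qed.

Lemma quotient_bounds h y : 0 < h ->
  y * expR (- (h * y)) <= (1 - expR (- (h * y))) / h <= y.
Proof.
move=> h0; rewrite ler_pdivlMr// ler_pdivrMr//; apply/andP; split.
  by rewrite mulrAC (mulrC y); exact: mul_expRN_le.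
by rewrite (mulrC y); exact: onem_expRN_le.
Qed.

Let h_gt0 (k : nat) : 0 < k.+1%:R^-1 :> R.
Proof. by rewrite invr_gt0. Qed.

Lemma laplace_quotient_ge0_le s k t : 0 <= t ->
  0 <= laplace_quotient s k t <= t * expR (- (s * t)).
Proof.
move=> t0; have /andP[b1 b2] := quotient_bounds t (h_gt0 k).
rewrite laplace_quotientE (mulrC t) ler_wpM2l ?expR_ge0// andbT.
by rewrite mulr_ge0 ?expR_ge0// (le_trans _ b1)// mulr_ge0 ?expR_ge0.
Qed.

(** The derivative of [1 - expR (- y)] at [0] is [1], along [y = h * b]. *)
Lemma quotient_cvg (b : R^nat) (B : R) : b k @[k --> \oo] --> B ->
  (1 - expR (- (k.+1%:R^-1 * b k))) / k.+1%:R^-1 @[k --> \oo] --> B.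
Proof.
move=> bB.
have hB : b k * expR (- (k.+1%:R^-1 * b k)) @[k --> \oo] --> B.
  have BE : B * expR (- (0 * B)) = B by rewrite mul0r oppr0 expR0 mulr1.
  rewrite -[X in _ --> X]BE.
  apply: cvgM => //.
  apply: continuous_cvg; first exact: continuous_expR.
  by apply: cvgN; apply: cvgM => //; exact: cvg_harmonic.
apply: (squeeze_cvgr _ hB bB).
by apply: nearW => k; exact: quotient_bounds.
Qed.

Lemma laplace_quotient_cvg s t :
  laplace_quotient s k t @[k --> \oo] --> t * expR (- (s * t)).
Proof.
rewrite (funext (fun k => laplace_quotientE s k t)) [t * _]mulrC.
by apply: cvgM; [exact: cvg_cst|apply: quotient_cvg; exact: cvg_cst].
Qed.

Lemma integral_laplace_quotient_cvg (m : {measure set R -> \bar R}) (D : set R) s :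
  measurable D -> D `<=` `[0, +oo[ ->
  m.-integrable D (fun t => (t * expR (- (s * t)))%:E) ->
  (\int[m]_(t in D) (laplace_quotient s k t)%:E)%E @[k --> \oo] -->
  (\int[m]_(t in D) (t * expR (- (s * t)))%:E)%E.
Proof.
move=> mD D0 iD.
have D0' t : D t -> 0 <= t by move=> /D0; rewrite /= in_itv/= andbT.
have [|||||_ _] := @dominated_convergence _ _ _ m D mD
  (fun k t => (laplace_quotient s k t)%:E) (fun t => (t * expR (- (s * t)))%:E)
  (fun t => (t * expR (- (s * t)))%:E); last by [].
- move=> k; apply/measurable_EFinP/measurable_funTS.
  apply: measurable_funM => //.
  by apply: measurable_funB; exact: measurable_expRN.
- exact: measurable_int iD.
- apply: aeW => t _; apply: cvg_EFin; first exact: nearW.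
  exact: laplace_quotient_cvg.
- exact: iD.
- apply: aeW => t k /D0' t0; rewrite /= lee_fin.
  by have /andP[a b] := laplace_quotient_ge0_le s k t0; rewrite ger0_norm.
Qed.

Section ID_plus.
Variables (mu : probability R R) (nu : {measure set R -> \bar R}).
Hypothesis ID : ID_plus mu nu.

Let levy_nu := ID_plus_levy ID.

Let pos_ge0 t : (`[0, +oo[%classic : set R) t -> 0 <= t.
Proof. by rewrite /= in_itv/= andbT. Qed.

Let pos_gt0 t : (`]0, +oo[%classic : set R) t -> 0 < t.
Proof. by rewrite /= in_itv/= andbT. Qed.

Lemma mu_integrable_bounded (f : R -> R) (C : R) : measurable_fun setT f ->
  (forall t, 0 <= t -> `|f t| <= C) ->
  mu.-integrable `[0, +oo[ (fun t => (f t)%:E).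
Proof.
move=> mf fC; apply: (@le_integrable _ _ _ mu _ _ _ (cst C%:E)) => //.
- by apply/measurable_EFinP; exact: measurable_funTS.
- by move=> t /pos_ge0 t0; rewrite /= lee_fin (le_trans (fC t t0))// ler_norm.
- exact: finite_measure_integrable_cst.
Qed.

Lemma nu_integrable_bounded (f : R -> R) (C : R) : measurable_fun setT f ->
  (forall t, 0 < t -> `|f t| <= C * Num.min 1 t) ->
  nu.-integrable `]0, +oo[ (fun t => (f t)%:E).
Proof.
move=> mf fC.
apply: (@le_integrable _ _ _ nu _ _ _ (fun t => (C%:E * (Num.min 1 t)%:E)%E)) => //.
- by apply/measurable_EFinP; exact: measurable_funTS.
- by move=> t /pos_gt0 t0; rewrite -EFinM /= lee_fin (le_trans (fC t t0))// ler_norm.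
- apply: integrableZl => //; apply/integrableP; split.
    by apply/measurable_EFinP/measurable_funTS/measurable_minr.
  have [_ _ ] := levy_nu; congr (_ < _)%E; apply: eq_integral => t.
  rewrite inE => /pos_gt0 t0.
  by rewrite /= ger0_norm// le_min ler01 ltW.
Qed.

Let measurable_mul_expRN s : measurable_fun setT (fun t : R => t * expR (- (s * t))).
Proof. by apply: measurable_funM => //; exact: measurable_expRN. Qed.

Lemma mul_expRN_le_inv s t : 0 < s -> 0 <= t -> t * expR (- (s * t)) <= s^-1.
Proof.
move=> s0 t0; rewrite expRN ler_pdivrMr ?expR_gt0// ler_pdivlMl//.
by apply: le_trans (expR_ge1Dx _); rewrite lerDr.
Qed.

Lemma mu_integrable_size s : 0 < s ->
  mu.-integrable `[0, +oo[ (fun t => (t * expR (- (s * t)))%:E).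
Proof.
move=> s0; apply: (@mu_integrable_bounded _ s^-1) => // t t0.
by rewrite ger0_norm ?mulr_ge0 ?expR_ge0// mul_expRN_le_inv.
Qed.

Lemma nu_integrable_size s : 0 < s ->
  nu.-integrable `]0, +oo[ (fun t => (t * expR (- (s * t)))%:E).
Proof.
move=> s0; apply: (@nu_integrable_bounded _ (1 + s^-1)) => // t t0.
have si0 : 0 < s^-1 by rewrite invr_gt0.
rewrite ger0_norm ?mulr_ge0 ?expR_ge0 ?(ltW t0)//.
have h1 := mul_expRN_le_inv s0 (ltW t0).
have h2 : t * expR (- (s * t)) <= t.
  rewrite ler_piMr ?(ltW t0)//.
  by have /andP[] := expRN_ge0_le1 (ltW s0) (ltW t0).
have := mulr_gt0 si0 t0.
by rewrite minEle; case: ifP => _; lra.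
Qed.

Let L s := fine (\int[mu]_(t in `[0%R, +oo[%classic) (expR (- (s * t)))%:E)%E.
Let psi s := fine (\int[nu]_(t in `]0%R, +oo[%classic) (expR (- (s * t)) - 1)%:E)%E.

Let mu_integrable_exp s : 0 <= s ->
  mu.-integrable `[0, +oo[ (fun t => (expR (- (s * t)))%:E).
Proof.
move=> s0; apply: (@mu_integrable_bounded _ 1); first exact: measurable_expRN.
by move=> t t0; rewrite ger0_norm ?expR_ge0//; have /andP[] := expRN_ge0_le1 s0 t0.
Qed.

Let nu_integrable_exp s : 0 <= s ->
  nu.-integrable `]0, +oo[ (fun t => (expR (- (s * t)) - 1)%:E).
Proof.
move=> s0; apply: (@nu_integrable_bounded _ (1 + s)).
  by apply: measurable_funB => //; exact: measurable_expRN.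
move=> t t0; rewrite distrC.
have /andP[h0 h1] := onem_expRN_ge0_le1 s0 (ltW t0).
rewrite ger0_norm//.
have h2 := onem_expRN_le (s * t).
have := mulr_ge0 s0 (ltW t0).
by rewrite minEle; case: ifP => _; lra.
Qed.

Let LE s : 0 <= s -> L s = expR (psi s).
Proof.
move=> s0; have [_ _ _ /(_ s s0)] := ID; rewrite /L => ->.
rewrite -[X in expeR X]fineK//.
by apply: integrable_fin_num => //; exact: nu_integrable_exp.
Qed.

Let L_quotient s k : 0 <= s -> (\int[mu]_(t in `[0%R, +oo[%classic)
  (laplace_quotient s k t)%:E)%E =
  ((L s - L (s + k.+1%:R^-1)) / k.+1%:R^-1)%:E.
Proof.
move=> s0; have s'0 : 0 <= s + k.+1%:R^-1 by rewrite addr_ge0// invr_ge0.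
rewrite EFinM EFinB !fineK; [|by apply: integrable_fin_num => //; exact: mu_integrable_exp..].
rewrite -integralB//; [|exact: mu_integrable_exp..].
by rewrite -integralZr//; apply: integrableB => //; exact: mu_integrable_exp.
Qed.

Let psi_quotient s k : 0 <= s -> (\int[nu]_(t in `]0%R, +oo[%classic)
  (laplace_quotient s k t)%:E)%E =
  ((psi s - psi (s + k.+1%:R^-1)) / k.+1%:R^-1)%:E.
Proof.
move=> s0; have s'0 : 0 <= s + k.+1%:R^-1 by rewrite addr_ge0// invr_ge0.
rewrite EFinM EFinB !fineK; [|by apply: integrable_fin_num => //; exact: nu_integrable_exp..].
rewrite -integralB//; [|exact: nu_integrable_exp..].
rewrite -integralZr//; last by apply: integrableB => //; exact: nu_integrable_exp.
apply: eq_integral => t _; rewrite -EFinB -EFinM; congr EFin.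
by rewrite /laplace_quotient opprB addrA subrK.
Qed.

(** The Laplace transform [L] of [mu] is [expR psi], so [L' = L * psi']; both
    derivatives are limits of difference quotients with steps [1 / (k + 1)]
    taken under the integral sign, dominated by the integrand of the
    derivative. *)
Lemma laplace_derivative s : 0 < s ->
  (\int[mu]_(t in `[0%R, +oo[%classic) (t * expR (- (s * t)))%:E =
   \int[mu]_(t in `[0%R, +oo[%classic) (expR (- (s * t)))%:E *
   \int[nu]_(t in `]0%R, +oo[%classic) (t * expR (- (s * t)))%:E)%E.
Proof.
move=> s0; have s0' := ltW s0.
have A := integral_laplace_quotient_cvg (measurable_itv `[0, +oo[)
  (@subset_refl _ _) (mu_integrable_size s0).
have D0 : `]0, +oo[%classic `<=` (`[0, +oo[%classic : set R).
  by move=> t/=; rewrite !in_itv/= !andbT => /ltW.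
have B := integral_laplace_quotient_cvg (measurable_itv `]0, +oo[)
  D0 (nu_integrable_size s0).
have Afin := integrable_fin_num (measurable_itv _) (mu_integrable_size s0).
have Bfin := integrable_fin_num (measurable_itv _) (nu_integrable_size s0).
have Lfin := integrable_fin_num (measurable_itv _) (mu_integrable_exp s0').
rewrite -(fineK Afin) -(fineK Bfin) -(fineK Lfin) -EFinM -/(L s); congr EFin.
have {}A : (L s - L (s + k.+1%:R^-1)) / k.+1%:R^-1 @[k --> \oo] -->
    fine (\int[mu]_(t in `[0%R, +oo[%classic) (t * expR (- (s * t)))%:E)%E.
  move: A; rewrite -(fineK Afin) (funext (fun k => L_quotient k s0')).
  by move=> /fine_cvgP[].
have {}B : (psi s - psi (s + k.+1%:R^-1)) / k.+1%:R^-1 @[k --> \oo] -->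
    fine (\int[nu]_(t in `]0%R, +oo[%classic) (t * expR (- (s * t)))%:E)%E.
  move: B; rewrite -(fineK Bfin) (funext (fun k => psi_quotient k s0')).
  by move=> /fine_cvgP[].
apply: (cvg_unique _ A) => //.
have h := cvgM (cvg_cst (L s)) (quotient_cvg B).
rewrite (_ : (fun k => _) = (fun k => L s * ((1 - expR (- (k.+1%:R^-1 *
    ((psi s - psi (s + k.+1%:R^-1)) / k.+1%:R^-1)))) / k.+1%:R^-1))); first exact: h.
apply/funext => k.
have h0 : k.+1%:R^-1 != 0 :> R by rewrite invr_eq0.
have s'0 : 0 <= s + k.+1%:R^-1 by rewrite addr_ge0// invr_ge0.
rewrite mulrA; congr (_ / _); rewrite mulrBr mulr1; congr (_ - _).
by rewrite (mulrC k.+1%:R^-1) divfK// !LE// -expRD; congr expR; ring.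
Qed.

End ID_plus.

End laplace_derivative.

(** * The size-biased identity *)

Section size_identity.
Context (R : realType) (mu : probability R R) (nu : {measure set R -> \bar R}).
Hypothesis ID : ID_plus mu nu.

Let M := (mu \x levy_sigma (ID_plus_levy ID))%E.

Definition quadrant : set (R * R) := `[0, +oo[ `*` `]0, +oo[.

Lemma measurable_quadrant : measurable quadrant.
Proof. exact: measurableX. Qed.

Lemma quadrantP z : quadrant z <-> 0 <= z.1 /\ 0 < z.2.
Proof. by rewrite /quadrant/= !in_itv/= !andbT. Qed.

#[local] Hint Resolve measurable_quadrant : core.

Let measurable_sum : measurable_fun setT (fun z : R * R => z.1 + z.2).
Proof. exact: measurable_funD. Qed.

Lemma integral_quadrant_mul (f g : R -> R) :
  measurable_fun setT f -> measurable_fun setT g ->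
  (forall t, 0 <= t -> 0 <= f t) -> (forall t, 0 < t -> 0 <= g t) ->
  (\int[M]_z (\1_quadrant z * (f z.1 * g z.2))%:E =
   \int[mu]_(u in `[0%R, +oo[%classic) (f u)%:E *
   \int[nu]_(t in `]0%R, +oo[%classic) (g t)%:E)%E.
Proof.
move=> mf mg f0 g0.
have h0 z : 0 <= \1_quadrant z * (f z.1 * g z.2).
  rewrite indicE; have [|_] := boolP (z \in quadrant); last by rewrite mul0r.
  by rewrite inE => /quadrantP[z1 z2]; rewrite mul1r mulr_ge0 ?f0 ?g0.
have mh : measurable_fun setT (fun z : R * R => (\1_quadrant z * (f z.1 * g z.2))%:E).
  apply/measurable_EFinP; apply: measurable_funM => //.
  by apply: measurable_funM; exact: measurableT_comp.
rewrite /M fubini_tonelli1//.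
rewrite /fubini_F -ge0_integralZr//; last 3 first.
- by apply/measurable_EFinP; exact: measurable_funTS.
- by move=> u /=; rewrite in_itv/= andbT lee_fin => /f0.
- by apply: integral_ge0 => t /=; rewrite in_itv/= andbT lee_fin => /g0.
rewrite [RHS]integral_mkcond; apply: eq_integral => u _.
rewrite patchE; case: ifPn; rewrite ?inE ?notin_setE/= in_itv/= andbT => u0.
  rewrite -ge0_integralZl//; last 3 first.
  - by apply/measurable_EFinP; exact: measurable_funTS.
  - by move=> t /=; rewrite in_itv/= andbT lee_fin => /g0.
  - by rewrite lee_fin f0.
  rewrite [RHS]integral_mkcond; apply: eq_integral => t _.
  rewrite patchE indicE; case: ifPn; rewrite ?inE ?notin_setE/= in_itv/= andbT => t0.
    by rewrite mem_set ?mul1r//; exact/quadrantP.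
  by rewrite memNset ?mul0r// => /quadrantP[].
rewrite integral0_eq// => t _.
by rewrite indicE memNset ?mul0r// => /quadrantP[/= z1 _]; exact: u0.
Qed.

(* The densities of [t mu(dt)] and of [mu(du) t nu(dt)], damped by the
   exponential of the total size to make the measures finite. *)
Let w1 t : R := \1_(`[0, +oo[%classic) t * (t * expR (- (1 * t))).
Let w2 (z : R * R) : R := \1_quadrant z *
  (expR (- (1 * z.1)) * (z.2 * expR (- (1 * z.2)))).

Let w1_ge0 t : 0 <= w1 t.
Proof.
rewrite /w1 indicE; have [|_] := boolP (t \in _); last by rewrite mul0r.
by rewrite inE/= in_itv/= andbT => t0; rewrite !mulr_ge0 ?expR_ge0.
Qed.

Let w2_ge0 z : 0 <= w2 z.
Proof.
rewrite /w2 indicE; have [|_] := boolP (z \in _); last by rewrite mul0r.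
by rewrite inE => /quadrantP[z1 z2]; rewrite !mulr_ge0 ?expR_ge0// ltW.
Qed.

Let measurable_w1 : measurable_fun setT w1.
Proof.
apply: measurable_funM => //; apply: measurable_funM => //.
exact: measurable_expRN.
Qed.

Let measurable_w2 : measurable_fun setT w2.
Proof.
apply: measurable_funM => //; apply: measurable_funM.
  exact: (measurableT_comp (measurable_expRN 1)).
apply: measurable_funM => //.
exact: (measurableT_comp (measurable_expRN 1)).
Qed.

Let alpha := density mu w1_ge0 measurable_w1.
Let beta := pushforward (density M w2_ge0 measurable_w2) (fun z => z.1 + z.2).

Let integral_alpha (f : R -> \bar R) : measurable_fun setT f ->
  (forall t, 0 <= f t)%E ->
  (\int[alpha]_t f t = \int[mu]_t (f t * (w1 t)%:E))%E.
Proof. by move=> mf f0; exact: ge0_integral_density. Qed.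

Let integral_beta (f : R -> \bar R) : measurable_fun setT f ->
  (forall t, 0 <= f t)%E ->
  (\int[beta]_t f t = \int[M]_z (f (z.1 + z.2)%R * (w2 z)%:E))%E.
Proof.
move=> mf f0; rewrite ge0_integral_pushforward// preimage_setT.
rewrite ge0_integral_density//; last by move=> z; exact: f0.
exact: measurableT_comp.
Qed.

Let laplace_alpha n :
  (\int[alpha]_(t in `[0%R, +oo[%classic) (expR (- (n%:R * t)))%:E =
   \int[mu]_(t in `[0%R, +oo[%classic) (t * expR (- (n.+1%:R * t)))%:E)%E.
Proof.
rewrite [LHS]integral_mkcond integral_alpha; last 2 first.
- apply/(measurable_restrictT _ _).1 => //; apply/measurable_EFinP/measurable_funTS.
  exact: measurable_expRN.
- by move=> t; apply: erestrict_ge0 => u _; rewrite lee_fin expR_ge0.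
rewrite [RHS]integral_mkcond; apply: eq_integral => t _.
rewrite !patchE; case: ifPn => t0; last by rewrite mul0e.
rewrite -EFinM /w1 indicE t0 /= mulr1n !mul1r; congr EFin.
rewrite mulrCA -expRD; congr (_ * expR _).
by rewrite -natr1; ring.
Qed.

Let laplace_beta n :
  (\int[beta]_(t in `[0%R, +oo[%classic) (expR (- (n%:R * t)))%:E =
   \int[mu]_(t in `[0%R, +oo[%classic) (expR (- (n.+1%:R * t)))%:E *
   \int[nu]_(t in `]0%R, +oo[%classic) (t * expR (- (n.+1%:R * t)))%:E)%E.
Proof.
rewrite [LHS]integral_mkcond integral_beta; last 2 first.
- apply/(measurable_restrictT _ _).1 => //; apply/measurable_EFinP/measurable_funTS.
  exact: measurable_expRN.
- by move=> t; apply: erestrict_ge0 => u _; rewrite lee_fin expR_ge0.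
rewrite -(integral_quadrant_mul (f := fun t => expR (- (n.+1%:R * t)))
  (g := fun t => t * expR (- (n.+1%:R * t)))); last 4 first.
- exact: measurable_expRN.
- by apply: measurable_funM => //; exact: measurable_expRN.
- by move=> t _; exact: expR_ge0.
- by move=> t t0; rewrite mulr_ge0 ?expR_ge0// ltW.
apply: eq_integral => z _; rewrite patchE /w2 indicE.
have [|zq] := boolP (z \in quadrant); last by rewrite !mul0r mule0.
rewrite inE => /quadrantP[z1 z2]; rewrite mem_set/=; last first.
  by rewrite in_itv/= andbT addr_ge0// ltW.
rewrite -EFinM /= ?mulr1n !mul1r; congr EFin.
have eS t : expR (- (n.+1%:R * t)) = expR (- (n%:R * t)) * expR (- t).
  by rewrite -expRD -natr1; congr expR; ring.
rewrite !eS mulrDr opprD expRD.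
by set a := expR (- (_ * z.1)); set b := expR (- (_ * z.2)); ring.
Qed.

Let alpha_beta A : measurable A -> alpha A = beta A.
Proof.
have la n : (\int[alpha]_(t in `[0%R, +oo[%classic) (expR (- (n%:R * t)))%:E)%E =
    (\int[beta]_(t in `[0%R, +oo[%classic) (expR (- (n%:R * t)))%:E)%E.
  rewrite laplace_alpha laplace_beta; exact: (laplace_derivative ID).
have aneg : alpha `]-oo, 0[%classic = 0%E.
  rewrite /alpha /density integral0_eq// => t /=; rewrite in_itv/= => t0.
  rewrite /w1 indicE memNset ?mul0r//=.
  by rewrite in_itv/= andbT; apply/negP; rewrite -ltNge.
have bneg : beta `]-oo, 0[%classic = 0%E.
  rewrite /beta /pushforward /density integral0_eq// => z /=; rewrite in_itv/= => z0.
  rewrite /w2 indicE memNset ?mul0r// => /quadrantP[z1 z2].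
  by move: z0; rewrite ltNge addr_ge0// ltW.
have aT : alpha setT = alpha `[0, +oo[%classic.
  by rewrite -[in RHS](setTI `[0, +oo[%classic); exact: negative_null_setI aneg _.
have bT : beta setT = beta `[0, +oo[%classic.
  by rewrite -[in RHS](setTI `[0, +oo[%classic); exact: negative_null_setI bneg _.
have int1 (m : {measure set R -> \bar R}) :
    (\int[m]_(t in `[0%R, +oo[%classic) (expR (- (0%:R * t)))%:E)%E =
    m `[0, +oo[%classic.
  under eq_integral do rewrite mul0r oppr0 expR0.
  by rewrite integral_cst// mul1e.
have afin : (alpha setT < +oo)%E.
  rewrite aT; apply: (eq_ind _ (fun y => (y < +oo)%E) _ _ (int1 [the measure _ _ of alpha])).
  rewrite laplace_alpha.
  have /integrable_fin_num := mu_integrable_size mu (ltr0Sn R 0).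
  by move=> /(_ (measurable_itv _)); rewrite fin_numElt => /andP[].
have bfin : (beta setT < +oo)%E.
  rewrite bT; apply: (eq_ind _ (fun y => (y < +oo)%E) _ _ (int1 [the measure _ _ of beta])).
  rewrite -la; apply: (eq_ind_r (fun y => (y < +oo)%E) _ (int1 [the measure _ _ of alpha])).
  exact: (eq_ind _ (fun y => (y < +oo)%E) afin _ aT).
exact: laplace_unique.
Qed.

(** By the derivative of the Laplace identity and uniqueness, [t mu(dt)] is the
    convolution of [mu] with [t nu(dt)]; integrating [1 / t] over the ray beyond
    [x] yields the identity. *)
Lemma mu_ray_integral x : 0 <= x ->
  mu `]x, +oo[%classic = (\int[M]_z (\1_quadrant z *
    (\1_[set z | x < z.1 + z.2] z * (z.2 / (z.1 + z.2))))%:E)%E.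
Proof.
move=> x0.
pose f t : R := \1_(`]x, +oo[%classic) t * (expR t * t `^ (- 1)).
have mf : measurable_fun setT (fun t => (f t)%:E).
  apply/measurable_EFinP; apply: measurable_funM => //.
  by apply: measurable_funM; [exact: measurable_expR|exact: measurable_powR].
have f0 t : (0 <= (f t)%:E)%E.
  rewrite lee_fin /f indicE; have [|_] := boolP (t \in _); last by rewrite mul0r.
  by move=> _; rewrite !mulr_ge0 ?expR_ge0 ?powR_ge0.
have fE : (\int[alpha]_t (f t)%:E = \int[beta]_t (f t)%:E)%E.
  by apply: eq_measure_integral => A mA _; exact: alpha_beta.
transitivity (\int[alpha]_t (f t)%:E)%E; last first.
  rewrite fE integral_beta//; apply: eq_integral => z _.
  rewrite /w2 indicE; have [|zq] := boolP (z \in quadrant); last first.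
    by rewrite !mul0r mule0.
  rewrite inE => /quadrantP[z1 z2]; rewrite -EFinM; congr EFin.
  rewrite /= mulr1n !mul1r /f !indicE.
  have -> : (z \in [set z : R * R | x < z.1 + z.2]) =
      (z.1 + z.2 \in (`]x, +oo[%classic : set R)).
    by apply/idP/idP; rewrite !inE/= in_itv/= andbT.
  have z12 : z.1 + z.2 != 0 by rewrite gt_eqF// ltr_wpDl.
  rewrite powR_inv1 ?addr_ge0 ?(ltW z2)// expRN expRN expRD.
  by field; rewrite z12 !gt_eqF ?expR_gt0.
rewrite integral_alpha//.
transitivity (\int[mu]_t (\1_(`]x, +oo[%classic) t)%:E)%E.
  by rewrite integral_indic// setIT.
apply: eq_integral => t _.
rewrite -EFinM; congr EFin; rewrite /f /w1 !indicE.
have [|] := boolP (t \in (`]x, +oo[%classic : set R)); last by rewrite !mul0r.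
rewrite inE/= in_itv/= andbT => xt; have t0 := le_lt_trans x0 xt.
rewrite mem_set/=; last by rewrite in_itv/= andbT ltW.
rewrite !mulr1n !mul1r powR_inv1 ?(ltW t0)// expRN.
by field; rewrite !gt_eqF ?expR_gt0.
Qed.

End size_identity.
Arguments quadrant {R}.

(** * Comparison of the two tails *)

Section tail_bounds.
Context (R : realType) (mu : probability R R) (nu : {measure set R -> \bar R}).
Hypothesis ID : ID_plus mu nu.

Let M := (mu \x levy_sigma (ID_plus_levy ID))%E.
Let nu1 := normalized_levy nu.
Let lam := fine (nu `]1, +oo[%classic).

Let nu_fin t : 0 < t -> nu `]t, +oo[%classic \is a fin_num.
Proof.
by move=> t0; rewrite ge0_fin_numE//; exact: levy_ray_lty (ID_plus_levy ID) _ t0.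
Qed.

Let nu_gt0 t : 0 < t -> (0 < nu `]t, +oo[%classic)%E.
Proof. by case: (ID_plus_levy ID) => _ h _; exact: h. Qed.

Let lam_gt0 : 0 < lam.
Proof. by rewrite fine_gt0// nu_gt0//= ltey_eq nu_fin. Qed.

Let nu1E A : measurable A ->
  nu1 A = (nu (A `&` `]1%R, +oo[%classic) * lam^-1%:E)%E.
Proof.
move=> mA; rewrite /nu1 /normalized_levy /= /mnormalize /= /mrestr setTI.
by rewrite gt_eqF ?nu_gt0//= lt_eqF// ltey_eq nu_fin.
Qed.

Let nu_ray y : 1 <= y -> nu `]y, +oo[%classic = (lam * tail nu1 y)%:E.
Proof.
move=> y1; rewrite EFinM EFin_tail nu1E// setIidl; last exact: ray_subset.
by rewrite muleCA -EFinM divff ?gt_eqF// mule1.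
Qed.

Lemma normalized_levy_ge0 : nu1 `]-oo, 0[%classic = 0%E.
Proof.
rewrite nu1E// (_ : _ `&` _ = set0) ?measure0 ?mul0e//.
by apply/seteqP; split => z //=; rewrite !in_itv/= andbT => -[]; lra.
Qed.

Lemma normalized_levy_gt0 x : 0 < tail nu1 x.
Proof.
apply: (@lt_le_trans _ _ (tail nu1 (Num.max 1 x))); last first.
  by apply: tail_noninc; rewrite le_max lexx orbT.
have m1 : 1 <= Num.max 1 x by rewrite le_max lexx.
have : (0 < (lam * tail nu1 (Num.max 1 x))%:E)%E.
  by rewrite -nu_ray// nu_gt0// (lt_le_trans _ m1).
by rewrite lte_fin pmulr_rgt0.
Qed.

Let M_exceed T x : 1 <= T ->
  M (exceed_set T x) = (lam * both_exceed mu nu1 T x)%:E.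
Proof.
move=> T1; rewrite /M exceed_integral EFinM EFin_both_exceed.
have mm : measurable_fun `]T, +oo[%classic
    (fun y => nu1 `](Num.max T (x - y))%R, +oo[%classic).
  exact: measurable_fun_exceed_ray.
rewrite -ge0_integralZl//; last by rewrite lee_fin ltW.
apply: eq_integral => y _ /=; rewrite /levy_sigma.
by rewrite nu_ray ?EFinM ?EFin_tail// le_max T1.
Qed.

Let weight (x : R) (z : R * R) : R := \1_quadrant z *
    (\1_[set z | x < z.1 + z.2] z * (z.2 / (z.1 + z.2))).

Let weight_ge0 x z : 0 <= weight x z.
Proof.
rewrite /weight indicE; have [|_] := boolP (z \in quadrant); last by rewrite mul0r.
rewrite inE => /quadrantP[z1 z2].
by rewrite indicE !mulr_ge0 ?invr_ge0 ?addr_ge0 ?(ltW z2).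
Qed.

Let measurable_weight x : measurable_fun setT (fun z => (weight x z)%:E).
Proof.
have -> : (fun z => (weight x z)%:E) = (fun z => (\1_quadrant z *
    (\1_[set z | x < z.1 + z.2] z * (z.2 * (z.1 + z.2) `^ (- 1))))%:E).
  apply/funext => z; rewrite /weight [\1_quadrant z]indicE; congr EFin.
  have [|_] := boolP (z \in quadrant); last by rewrite !mul0r.
  by rewrite inE => /quadrantP[z1 z2]; rewrite powR_inv1// addr_ge0// ltW.
apply/measurable_EFinP; apply: measurable_funM.
  by apply: measurable_indic; exact: measurable_quadrant.
apply: measurable_funM; first by apply: measurable_indic; exact: measurable_sum_gt.
apply: measurable_funM => //.
have madd : measurable_fun setT (fun z : R * R => z.1 + z.2).
  exact: measurable_funD.
have mpow : measurable_fun setT (fun t : R => t `^ (- 1)) by exact: measurable_powR.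
by have := measurableT_comp mpow madd.
Qed.

Let integral_indic_pos (m : {measure set R -> \bar R}) (D A : set R) :
  measurable D -> measurable A -> A `<=` D ->
  (\int[m]_(t in D) (\1_A t)%:E = m A)%E.
Proof. by move=> mD mA AD; rewrite integral_indic// setIidl. Qed.

(** A single jump beyond [x], when the rest is at most [A], has weight at
    least one half. *)
Lemma levy_tail_le : tail_dominated nu1 mu.
Proof.
have h2 : 0 < 2^-1 :> R by rewrite invr_gt0.
have [A A1 tA] := near_pinfty_ex 1 (tail_small mu h2).
have mA : 2^-1 <= fine (mu `[0, A]%classic).
  have : 1 <= fine (mu `]-oo, 0[%classic) +
      fine (mu (`[0, A] `|` `]A, +oo[)%classic).
    have -> : 1 = fine (mu setT) by rewrite probability_setT.
    apply: fine_measure_leU => //; first exact: measurableU.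
    move=> z _ /=; rewrite !in_itv/= andbT.
    by case: (ltP z 0) => z0; [left|right; case: (leP z A) => zA; [left|right]].
  have [-> _ _ _] := ID; rewrite add0r.
  have := fine_measure_leU mu (measurableU _ _ (measurable_itv `[0, A])
    (measurable_itv `]A, +oo[)) (measurable_itv `[0, A])
    (measurable_itv `]A, +oo[) (@subset_refl _ _).
  by have := tA _ (lexx A); rewrite -!/(tail mu A); lra.
exists (4 / lam); first by rewrite divr_gt0.
exists A; split; [exact: num_real|] => x Ax.
have x1 : 1 <= x by rewrite (le_trans A1)// ltW.
have x0 : 0 <= x by rewrite (le_trans ler01).
suff : ((fine (mu `[0, A]%classic))%:E * (2^-1 * (lam * tail nu1 x))%:E <= (tail mu x)%:E)%E.
  rewrite -EFinM lee_fin => h; rewrite mulrAC ler_pdivlMr// mulrC.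
  have : 2^-1 * (2^-1 * (lam * tail nu1 x)) <= tail mu x.
    by apply: le_trans h; rewrite ler_wpM2r// !mulr_ge0// ?tail_ge0// ltW.
  by lra.
rewrite EFin_tail (mu_ray_integral ID x0) EFinM -nu_ray//.
pose f u : R := \1_(`[0, A]%classic) u.
pose g t : R := 2^-1 * \1_(`]x, +oo[%classic) t.
have mf : measurable_fun setT f by exact: measurable_indic.
have mg : measurable_fun setT g by apply: measurable_funM => //; exact: measurable_indic.
have f0 t : 0 <= f t by rewrite /f indicE.
have g0 t : 0 <= g t by rewrite /g indicE mulr_ge0// ltW.
have -> : ((fine (mu `[0, A]%classic))%:E =
    \int[mu]_(u in `[0%R, +oo[%classic) (f u)%:E)%E.
  rewrite integral_indic_pos//; first by rewrite fineK// fin_num_measure.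
  by move=> z /=; rewrite !in_itv/= andbT => /andP[].
have -> : (2^-1%:E * nu `]x, +oo[%classic)%E = (\int[nu]_(t in `]0%R, +oo[%classic) (g t)%:E)%E.
  rewrite /g; under eq_integral do rewrite EFinM.
  rewrite ge0_integralZl_EFin//; last first.
    by apply/measurable_EFinP; exact: measurable_indic.
  by rewrite integral_indic_pos//; exact: ray_subset.
rewrite -(integral_quadrant_mul ID mf mg)//.
apply: ge0_le_integral => //.
- move=> z _; rewrite lee_fin indicE; have [|_] := boolP (z \in quadrant).
    by rewrite !mulr_ge0.
  by rewrite mul0r.
- apply/measurable_EFinP; apply: measurable_funM.
    by apply: measurable_indic; exact: measurable_quadrant.
  by apply: measurable_funM; exact: measurableT_comp.
- exact: measurable_weight.
move=> z _; rewrite lee_fin [\1_quadrant z]indicE.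
have [|_] := boolP (z \in quadrant); last by rewrite !mul0r.
rewrite inE => /quadrantP[z1 z2]; rewrite ler_wpM2l//.
rewrite /f /g !indicE.
have [zA|_] := boolP (z.1 \in _); last first.
  by rewrite mul0r !mulr_ge0// ?invr_ge0 ?addr_ge0 ?(ltW z2).
have [zx|_] := boolP (z.2 \in _); last first.
  by rewrite !mulr0 !mulr_ge0// ?invr_ge0 ?addr_ge0 ?(ltW z2).
move: zA zx; rewrite !inE/= !in_itv/= andbT => /andP[_ zA] zx.
rewrite mem_set/=; last by lra.
rewrite !mulr1n !mul1r mulr1 ler_pdivlMr; first by lra.
by lra.
Qed.

(** Beyond [x], either the size-biased jump is at most [T], with weight at most
    [t / x], or the rest is at most [T], or both exceed [T]. *)
Lemma mu_tail_le T : 1 <= T -> exists2 c : R, 0 <= c & forall x, 2 * T <= x ->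
  tail mu x <= c / x * tail mu (x - T) + lam * tail nu1 (x - T) +
    lam * both_exceed mu nu1 T x.
Proof.
move=> T1; have T0 : 0 < T by rewrite (lt_le_trans ltr01).
pose g t : R := \1_(`]0, T]%classic) t * t.
have mg : measurable_fun setT g by apply: measurable_funM => //; exact: measurable_indic.
have g0 t : 0 <= g t.
  rewrite /g indicE; have [|_] := boolP (t \in _); last by rewrite mul0r.
  by rewrite inE/= in_itv/= => /andP[t0 _]; rewrite mul1r ltW.
have gfin : (\int[nu]_(t in `]0%R, +oo[%classic) (g t)%:E)%E \is a fin_num.
  apply: integrable_fin_num => //; apply: (nu_integrable_bounded ID (C := T)) => // t t0.
  rewrite ger0_norm// /g indicE; have [|_] := boolP (t \in _); last first.
    by rewrite mul0r mulr_ge0 ?(ltW T0)// le_min ler01 ltW.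
  rewrite inE/= in_itv/= => /andP[_ tT]; rewrite mul1r minEle.
  by case: ifP => _; [rewrite mulr1|rewrite ler_peMl// ltW].
exists (fine (\int[nu]_(t in `]0%R, +oo[%classic) (g t)%:E)%E).
  by rewrite fine_ge0//; apply: integral_ge0 => t _; rewrite lee_fin.
move=> x Tx; have x0 : 0 < x by lra.
have xT : 0 <= x - T by lra.
pose f u : R := x^-1 * \1_(`]x - T, +oo[%classic) u.
pose k t : R := \1_(`]x - T, +oo[%classic) t.
have mk : measurable_fun setT k by exact: measurable_indic.
have mf : measurable_fun setT f by exact: measurable_funM.
have k0 t : 0 <= k t by rewrite /k indicE.
have f0 t : 0 <= f t by rewrite /f mulr_ge0 ?invr_ge0 ?(ltW x0)// k0.
have sub0 : `]x - T, +oo[%classic `<=` (`[0, +oo[%classic : set R).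
  by move=> z /=; rewrite !in_itv/= !andbT; lra.
have fE : (\int[mu]_(u in `[0%R, +oo[%classic) (f u)%:E)%E = (x^-1 * tail mu (x - T))%:E.
  rewrite /f; under eq_integral do rewrite EFinM.
  rewrite ge0_integralZl_EFin//; last 2 first.
  - by apply/measurable_EFinP; exact: measurable_indic.
  - by rewrite invr_ge0 ltW.
  by rewrite integral_indic_pos// EFinM EFin_tail.
have kE : (\int[nu]_(t in `]0%R, +oo[%classic) (k t)%:E)%E = (lam * tail nu1 (x - T))%:E.
  rewrite integral_indic_pos//; last exact: ray_subset.
  by rewrite nu_ray//; lra.
have oneE : (\int[mu]_(u in `[0%R, +oo[%classic) ((cst 1 : R -> R) u)%:E <= 1)%E.
  by rewrite (eq_integral (cst 1%E))// integral_cst// mul1e probability_le1.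
have gE := integral_quadrant_mul ID mf mg (fun t _ => f0 t) (fun t _ => g0 t).
have cE := integral_quadrant_mul ID (measurable_cst (1 : R)) mk
  (fun t _ => ler01) (fun t _ => k0 t).
have mq : measurable_fun setT (\1_quadrant : R * R -> R).
  by apply: measurable_indic; exact: measurable_quadrant.
have mgf : measurable_fun setT (fun z : R * R =>
    (\1_quadrant z * (f z.1 * g z.2))%:E).
  apply/measurable_EFinP; apply: measurable_funM => //.
  by apply: measurable_funM; exact: measurableT_comp.
have mck : measurable_fun setT (fun z : R * R =>
    (\1_quadrant z * (cst 1 z.1 * k z.2))%:E).
  apply/measurable_EFinP; apply: measurable_funM => //.
  by apply: measurable_funM => //; exact: measurableT_comp.
have me : measurable_fun setT (fun z : R * R => (\1_(exceed_set T x) z : R)%:E).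
  by apply/measurable_EFinP; apply: measurable_indic; exact: measurable_exceed.
have q0 (a : R) z : 0 <= a -> 0 <= \1_quadrant z * a.
  by move=> a0; rewrite indicE mulr_ge0.
rewrite -lee_fin EFin_tail (mu_ray_integral ID (ltW x0)).
apply: (@le_trans _ _ (\int[M]_z ((\1_quadrant z * (f z.1 * g z.2))%:E +
   (\1_quadrant z * (cst 1 z.1 * k z.2))%:E + (\1_(exceed_set T x) z)%:E))%E).
  apply: ge0_le_integral => //.
  - by move=> z _; rewrite lee_fin; exact: weight_ge0.
  - exact: measurable_weight.
  - by apply: emeasurable_funD => //; exact: emeasurable_funD.
  move=> z _; rewrite -!EFinD lee_fin [\1_quadrant z]indicE.
  have [|_] := boolP (z \in quadrant); last by rewrite !mul0r !add0r indicE.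
  rewrite inE => /quadrantP[z1 z2]; rewrite /= !mulr1n !mul1r.
  have fg0 : 0 <= f z.1 * g z.2 by exact: mulr_ge0.
  have e0 : 0 <= \1_(exceed_set T x) z :> R by rewrite indicE.
  have k1 : 0 <= k z.2 by [].
  rewrite [\1_[set z0 : R * R | x < z0.1 + z0.2] z]indicE.
  have [|_] := boolP (z \in [set z : R * R | x < z.1 + z.2]); last first.
    by rewrite mul0r; apply: addr_ge0 => //; exact: addr_ge0.
  rewrite inE/= => xz; rewrite mulr1n mul1r.
  have z120 : 0 < z.1 + z.2 by lra.
  have w1 : z.2 / (z.1 + z.2) <= 1 by rewrite ler_pdivrMr// mul1r lerDr.
  have [zT|zT] := leP z.2 T.
    suff : z.2 / (z.1 + z.2) <= f z.1 * g z.2 by lra.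
    rewrite /f /g !indicE mem_set/=; last by rewrite in_itv/= andbT; lra.
    rewrite mem_set/=; last by rewrite in_itv/= z2.
    by rewrite !mulr1n mulr1 mul1r mulrC ler_wpM2r ?(ltW z2)// lef_pV2 ?posrE// ltW.
  have [z1T|z1T] := leP z.1 T.
    suff -> : k z.2 = 1 by lra.
    by rewrite /k indicE mem_set//= in_itv/= andbT; lra.
  suff -> : \1_(exceed_set T x) z = 1 :> R by lra.
  by rewrite indicE mem_set.
have qfg z : 0 <= \1_quadrant z * (f z.1 * g z.2) by apply: q0; exact: mulr_ge0.
have qck z : 0 <= \1_quadrant z * (cst 1 z.1 * k z.2) by apply: q0; exact: mulr_ge0.
rewrite ge0_integralD//; last 2 first.
- by move=> z _; rewrite adde_ge0// lee_fin.
- exact: emeasurable_funD.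
rewrite ge0_integralD//; last 2 first.
- by move=> z _; rewrite lee_fin.
- by move=> z _; rewrite lee_fin.
have iE : (\int[M]_z (\1_(exceed_set T x) z)%:E)%E =
    (lam * both_exceed mu nu1 T x)%:E.
  rewrite integral_indic ?setIT//; first exact: M_exceed.
  exact: measurable_exceed.
rewrite gE cE fE kE iE !EFinD; apply: leeD => //; apply: leeD.
  by rewrite -{1}(fineK gfin) -EFinM lee_fin mulrAC (mulrC x^-1).
by rewrite -[leRHS]mul1e lee_wpmul2r// lee_fin mulr_ge0 ?tail_ge0 ?ltW.
Qed.

Lemma ID_plus_ge0 : mu `]-oo, 0[%classic = 0%E.
Proof. by case: ID. Qed.

Lemma ID_plus_gt0 x : 0 < tail mu x.
Proof.
have [C C0 nm] := levy_tail_le.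
have [y xy /(_ _ (lexx y)) Cy] := near_pinfty_ex x nm.
apply: lt_le_trans (tail_noninc mu xy).
by rewrite -(pmulr_rgt0 _ C0) (lt_le_trans _ Cy)// normalized_levy_gt0.
Qed.

Let near_ge (a : R) : \forall x \near +oo, a <= x.
Proof. by apply: nbhs_pinfty_ge; exact: num_real. Qed.

(** The event that the rest and a jump both exceed [T] has a probability at
    most that for two independent copies with law [mu], up to a constant: it is
    negligible, and the tail of [mu] is due to one large jump. *)
Lemma mu_tail_dominated_mu : single_big_jump mu -> tail_dominated mu nu1.
Proof.
move=> smu.
have sb := single_big_jump_shift_bounded ID_plus_ge0 ID_plus_gt0 smu.
have [C C0 nm] := levy_tail_le.
have e0 : 0 < 4^-1 / (lam * C) by rewrite divr_gt0 ?mulr_gt0// invr_gt0.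
have [K sK] := smu _ e0.
have [T] := near_pinfty_ex (Num.max 1 K) nm.
rewrite ge_max => /andP[T1 KT] nmT.
have [c c0 mT] := mu_tail_le T1.
have [CT CT0 sT] := sb T.
have shift := near_pinfty_shift T.
exists (CT * (2 * lam)); first by rewrite !mulr_gt0.
have half : \forall x \near +oo, tail mu x <= 2 * lam * tail nu1 (x - T).
  near=> x.
  have Tx : 2 * T <= x by near: x; exact: near_ge.
  have mx := mT x Tx.
  have x0 : 0 < x by apply: (@lt_le_trans _ _ 1) => //; near: x; exact: near_ge.
  have h1 : lam * both_exceed mu nu1 T x <= 4^-1 * tail mu x.
    apply: (@le_trans _ _ (lam * (C * both_exceed mu mu T x))).
      by rewrite ler_pM2l// both_exceed_dominated_ray.
    have -> : 4^-1 * tail mu x = lam * (C * (4^-1 / (lam * C) * tail mu x)).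
      by field; rewrite !gt_eqF.
    rewrite !ler_pM2l// (le_trans (both_exceed_noninc mu mu x KT))//.
    by near: x.
  have h2 : c / x * tail mu (x - T) <= 4^-1 * tail mu x.
    apply: (@le_trans _ _ (c / x * (CT * tail mu x))).
      by rewrite ler_wpM2l ?divr_ge0 ?(ltW x0)//; near: x.
    by rewrite mulrA ler_wpM2r ?tail_ge0// mulrAC ler_pdivrMr// ler_pdivlMl.
  by lra.
have := shift _ half; have := shift _ sT.
apply: filterS2 => x; rewrite addrK => s1 h1.
by apply: (le_trans s1); rewrite -mulrA ler_pM2l.
Unshelve. all: by end_near.
Qed.

(** On a bounded interval the ratio of the two tails has a finite supremum [m].
    The estimate of the tail of [mu] bounds the ratio by a constant plus [m / 2]
    and hence [m] by twice that constant, whatever the interval. *)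
Lemma mu_tail_dominated_nu : single_big_jump nu1 -> tail_dominated mu nu1.
Proof.
move=> snu.
have sb := single_big_jump_shift_bounded normalized_levy_ge0 normalized_levy_gt0 snu.
have e0 : 0 < 4^-1 / lam by rewrite divr_gt0// invr_gt0.
have [K sK] := snu _ e0.
pose T := Num.max 1 K.
have T1 : 1 <= T by rewrite le_max lexx.
have KT : K <= T by rewrite le_max lexx orbT.
have [c c0 mT] := mu_tail_le T1.
have [CT CT0 sT] := sb T.
have step : \forall x \near +oo, [/\ 2 * T <= x, c / x * CT <= 4^-1,
    lam * both_exceed nu1 nu1 T x <= 4^-1 * tail nu1 x &
    tail nu1 (x - T) <= CT * tail nu1 x].
  near=> x.
  have x0 : 0 < x by apply: (@lt_le_trans _ _ 1) => //; near: x; exact: near_ge.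
  split.
  - by near: x; exact: near_ge.
  - by rewrite mulrAC ler_pdivrMr// ler_pdivlMl.
  - have -> : 4^-1 * tail nu1 x = lam * (4^-1 / lam * tail nu1 x).
      by field; rewrite gt_eqF.
    rewrite ler_pM2l// (le_trans (both_exceed_noninc nu1 nu1 x KT))//.
    by near: x.
  - by near: x.
have [X TX {}step] := near_pinfty_ex T step.
(* The first term covers the ratio before [X], where the tail of [mu] is at
   most one; half of the second covers the part where the rest is at most [T]. *)
pose Cs := Num.max (tail nu1 X)^-1 (2 * (lam * CT)).
have Cs0 : 0 < Cs by rewrite lt_max invr_gt0 normalized_levy_gt0.
pose valid (Y C : R) := forall y, T <= y <= Y -> tail mu y <= C * tail nu1 y.
have improve Y C : Cs <= C -> valid Y C -> valid Y ((C + Cs) / 2).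
  move=> CsC vC y /andP[Ty yY].
  have C0 : 0 <= C by rewrite (le_trans (ltW Cs0)).
  have nu0 := normalized_levy_gt0 y.
  have [yX|Xy] := ltP y X.
    apply: (@le_trans _ _ 1); first exact: tail_le1.
    rewrite -ler_pdivrMr// mul1r.
    apply: (@le_trans _ _ (tail nu1 X)^-1).
      by rewrite lef_pV2 ?posrE ?normalized_levy_gt0// tail_noninc// ltW.
    have : (tail nu1 X)^-1 <= Cs by rewrite le_max lexx.
    by lra.
  have [Ty2 cy by4 sy] := step _ Xy.
  have b1 : both_exceed mu nu1 T y <= C * both_exceed nu1 nu1 T y.
    rewrite both_exceedC; apply: both_exceed_dominated => z /andP[Tz zy].
    apply: vC; rewrite Tz/= (le_trans zy)// ge_max (le_trans Ty yY)/=.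
    by rewrite (le_trans _ yY)// lerBlDr lerDl (le_trans ler01).
  have yT : tail mu (y - T) <= C * tail nu1 (y - T).
    apply: vC; apply/andP; split; first by lra.
    by rewrite (le_trans _ yY)// lerBlDr lerDl (le_trans ler01).
  have y0 : 0 < y by rewrite (lt_le_trans _ Ty)// (lt_le_trans _ T1).
  have t1 : c / y * tail mu (y - T) <= C / 4 * tail nu1 y.
    apply: (@le_trans _ _ (c / y * (C * (CT * tail nu1 y)))).
      rewrite ler_wpM2l ?divr_ge0 ?(ltW y0)// (le_trans yT)//.
      by rewrite ler_wpM2l.
    have -> : c / y * (C * (CT * tail nu1 y)) = c / y * CT * (C * tail nu1 y) by ring.
    have -> : C / 4 * tail nu1 y = 4^-1 * (C * tail nu1 y) by ring.
    by rewrite ler_wpM2r// mulr_ge0// ltW.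
  have t2 : lam * tail nu1 (y - T) <= Cs / 2 * tail nu1 y.
    apply: (@le_trans _ _ (lam * (CT * tail nu1 y))); first by rewrite ler_pM2l.
    rewrite mulrA ler_pM2r//.
    have : 2 * (lam * CT) <= Cs by rewrite le_max lexx orbT.
    by lra.
  have t3 : lam * both_exceed mu nu1 T y <= C / 4 * tail nu1 y.
    apply: (@le_trans _ _ (lam * (C * both_exceed nu1 nu1 T y))).
      by rewrite ler_pM2l.
    rewrite mulrCA (_ : C / 4 * tail nu1 y = C * (4^-1 * tail nu1 y)); last by ring.
    by rewrite ler_wpM2l.
  have := mT y Ty2; lra.
exists Cs => //; exists T; split; first exact: num_real.
move=> Y TY.
pose S := [set tail mu y / tail nu1 y | y in `[T, Y]%classic].
have SC C : ubound S C <-> valid Y C.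
  split=> [uC y Ty|vC _ [y Ty <-]].
    by rewrite -ler_pdivrMr ?normalized_levy_gt0//; apply: uC; exists y.
  by rewrite ler_pdivrMr ?normalized_levy_gt0//; apply: vC; move: Ty; rewrite /= in_itv.
have S0 : S !=set0.
  by exists (tail mu Y / tail nu1 Y); exists Y => //=; rewrite in_itv/= lexx ltW.
have vY : valid Y (tail nu1 Y)^-1.
  move=> y /andP[_ yY]; apply: (le_trans (tail_le1 mu y)).
  by rewrite mulrC ler_pdivlMr ?normalized_levy_gt0// mul1r tail_noninc.
have hasS : has_sup S by split => //; exists (tail nu1 Y)^-1; exact/SC.
have vsup : valid Y (sup S) by apply/SC; exact: sup_upper_bound.
suff sCs : sup S <= Cs.
  apply: (@le_trans _ _ (sup S * tail nu1 Y)).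
    by apply: vsup; rewrite lexx ltW.
  by rewrite ler_wpM2r ?tail_ge0.
rewrite leNgt; apply/negP => Css.
have : sup S <= (sup S + Cs) / 2.
  by apply: ge_sup => //; apply/SC; apply: improve => //; exact: ltW.
by lra.
Unshelve. all: by end_near.
Qed.

End tail_bounds.

Theorem theorem24 (R : realType) (mu : probability R R)
    (nu : {measure set R -> \bar R}) (hmu : ID_plus mu nu) :
  (law_in_J mu <-> law_in_J (normalized_levy nu)) /\
  (law_in_J mu \/ law_in_J (normalized_levy nu) ->
   asymp_equiv (tail mu) (tail (normalized_levy nu))).
Proof.
have muJ := law_in_JP (ID_plus_ge0 hmu) (ID_plus_gt0 hmu).
have nuJ := law_in_JP (normalized_levy_ge0 hmu) (normalized_levy_gt0 hmu).
have nu_mu := levy_tail_le hmu.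
have mu_nu : law_in_J mu \/ law_in_J (normalized_levy nu) ->
    tail_dominated mu (normalized_levy nu).
  move=> [/muJ|/nuJ]; first exact: mu_tail_dominated_mu.
  exact: mu_tail_dominated_nu.
split.
  split=> J; have mn := mu_nu _.
    by apply/nuJ; apply: (single_big_jump_equiv nu_mu (mn (or_introl J))); exact/muJ.
  by apply/muJ; apply: (single_big_jump_equiv (mn (or_intror J)) nu_mu); exact/nuJ.
move=> /mu_nu[C C0 mn]; have [c c0 nm] := nu_mu.
apply: (asymp_equivP (c := c^-1) (C := C)) => //.
- by rewrite invr_gt0.
- by apply: nearW => x; exact: normalized_levy_gt0 hmu x.
- by apply: filterS nm => x; rewrite ler_pdivrMl.
Qed.
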